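(* Let $X$ be a Banach space. The following properties are equivalent: 1. $X$ has the Helly approximation property; 2. the dual space $X^*$ is of non-trivial type; 3. $X$ is of non-trivial type.
   Context: $\mathbf{B}_X$ denotes the (closed) unit ball of the Banach space $X$, and $\operatorname{dist}(x,K)=\inf_{z\in K}\|x-z\|$. The $R$-neighborhood of a set $A\subset X$ is $\{x\in X:\operatorname{dist}(x,A)\le R\}$. A sequence $\{r_k\}_{k\in\mathbb{N}}$ (with $\mathbb{N}=\{1,2,\dots\}$) is a Helly approximation sequence of $X$ if for every $k$ and every finite family $\mathcal{F}$ of convex subsets of $X$ the following holds: if any $k$ (not necessarily distinct) sets of $\mathcal{F}$ have a common point inside the unit ball $\mathbf{B}_X$, then the $r_k$-neighborhoods of all sets in $\mathcal{F}$ have a common point. $X$ has the Helly approximation property if it has a Helly approximation sequence with $r_k\to0$ as $k\to\infty$. Rademacher type: a Banach space $Y$ is of (Rademacher) type $p$, for some $p\ge1$, if there is a constant $T$ such that for every finite set $S$ of vectors in $Y$, the average norm of the $2^{|S|}$ vectors of the form $\sum_{s\in S}\pm s$ does not exceed $T\left(\sum_{s\in S}\|s\|^p\right)^{1/p}$. A space is of non-trivial type if its maximal type is strictly greater than one, i.e. it is of type $p$ for some $p>1$; otherwise it is of trivial type. *)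

(* Defs.v *)
From HB Require Import structures.
From mathcomp Require Import all_boot all_order all_algebra finmap.
From mathcomp Require Import all_classical all_reals all_analysis.

Set Implicit Arguments.
Unset Strict Implicit.
Unset Printing Implicit Defensive.
Import Order.TTheory GRing.Theory Num.Theory.
Import numFieldNormedType.Exports.

Local Open Scope classical_set_scope.
Local Open Scope ring_scope.

Definition unit_ball (R : realType) (X : normedModType R) : set X :=
  [set x | `|x| <= 1].

Section Dual.
Context (R : realType) (X : normedModType R).

Definition functional_pred : {pred X -> R^o} :=
  fun f => `[< linear f /\ continuous f >].

Record dual := Dual {
  dual_val :> X -> R^o;
  _ : dual_val \in functional_pred }.

HB.instance Definition _ := [isSub for dual_val].
HB.instance Definition _ := [Choice of dual by <:].

Lemma functional_submod_closed : GRing.submod_closed functional_pred.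
Proof.
split.
  apply/asboolP; split; first by move=> a x y; rewrite scaler0 addr0.
  exact: cst_continuous.
move=> a f g /asboolP[lf cf] /asboolP[lg cg]; apply/asboolP; split.
  move=> b x y; have -> z : (a *: f + g) z = a *: f z + g z by [].
  rewrite lf lg !scalerDr !scalerA (mulrC a b) -!addrA; congr (_ + _).
  by rewrite addrCA.
move=> x; apply: (@continuousD _ _ _ (a *: f) g x _ (cg x)).
exact: (@continuousZl_tmp _ _ _ f a x (cf x)).
Qed.

HB.instance Definition _ :=
  GRing.isSubmodClosed.Build R _ functional_pred functional_submod_closed.
HB.instance Definition _ := [SubChoice_isSubLmodule of dual by <:].

Definition dual_norm (f : dual) : R := sup [set `|f x| | x in @unit_ball R X].

Lemma dual_linear (f : dual) : linear (f : X -> R^o).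
Proof. by have /asboolP[] := valP f. Qed.

Lemma dual_continuous (f : dual) : continuous (f : X -> R^o).
Proof. by have /asboolP[] := valP f. Qed.

Lemma dual0 (f : dual) : f 0 = 0.
Proof. by have /(_ 0) := dual_linear f (-1) 0; rewrite scaler0 addr0 scaleN1r addNr. Qed.

Lemma dualZ (f : dual) a x : f (a *: x) = a * f x.
Proof. by rewrite -[a *: x]addr0 dual_linear dual0 addr0. Qed.

Lemma has_sup_dual (f : dual) : has_sup [set `|f x| | x in @unit_ball R X].
Proof.
split; first by exists `|f 0|; exists 0 => //=; rewrite /unit_ball/= normr0.
pose lf : {linear X -> R^o} :=
  HB.pack (f : X -> R^o) (GRing.isLinear.Build _ _ _ _ _ (dual_linear f)).
have /linear_bounded_continuous/linear_boundedP : continuous lf.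
  exact: dual_continuous.
move=> /pinfty_ex_gt0[M M0 fM]; exists M => _ [x x1 <-].
by apply: le_trans (fM x) _; rewrite ger_pMr.
Qed.

Lemma dual_norm_ub (f : dual) x : `|x| <= 1 -> `|f x| <= dual_norm f.
Proof.
move=> x1; apply: ub_le_sup; first by case: (has_sup_dual f).
by exists x.
Qed.

Lemma dual_norm_le (f : dual) M :
  (forall x, `|x| <= 1 -> `|f x| <= M) -> dual_norm f <= M.
Proof.
move=> fM; apply: ge_sup; first by case: (has_sup_dual f).
by move=> _ [x x1 <-]; exact: fM.
Qed.

Lemma dual_normD (f g : dual) : dual_norm (f + g) <= dual_norm f + dual_norm g.
Proof.
apply: dual_norm_le => x x1.
by rewrite (le_trans (ler_normD _ _))// lerD// dual_norm_ub.
Qed.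

Lemma dual_normZ_le a (f : dual) : dual_norm (a *: f) <= `|a| * dual_norm f.
Proof.
apply: dual_norm_le => x x1; have -> : (a *: f) x = a * f x by [].
by rewrite normrM ler_wpM2l// dual_norm_ub.
Qed.

Lemma dual_norm0 : dual_norm 0 = 0.
Proof.
apply/eqP; rewrite eq_le; apply/andP; split.
  by apply: dual_norm_le => x _; rewrite normr0.
by apply: le_trans (dual_norm_ub 0 (_ : `|0| <= 1)); rewrite ?normr0.
Qed.

Lemma dual_normZ a (f : dual) : dual_norm (a *: f) = `|a| * dual_norm f.
Proof.
have [->|a0] := eqVneq a 0; first by rewrite scale0r normr0 mul0r dual_norm0.
apply/eqP; rewrite eq_le dual_normZ_le/=.
rewrite -ler_pdivlMl ?normr_gt0// -normfV.
by rewrite -{1}[f]scale1r -(mulVf a0) -scalerA dual_normZ_le.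
Qed.

Lemma dual_norm_eq0 (f : dual) : dual_norm f = 0 -> f = 0.
Proof.
move=> f0; apply/val_inj/funext => x /=.
have [->|x0] := eqVneq x 0; first exact: dual0.
have nx0 : `|x| != 0 by rewrite normr_eq0.
have := @dual_norm_ub f (`|x|^-1 *: x).
rewrite normrZ normfV normr_id mulVf// lexx f0 dualZ => /(_ isT).
by rewrite normr_le0 mulf_eq0 invr_eq0 (negbTE nx0) => /eqP.
Qed.

HB.instance Definition _ :=
  @Lmodule_isNormed.Build R dual dual_norm dual_normD dual_normZ dual_norm_eq0.

End Dual.

Section RademacherType.
Context (R : realType) (Y : normedModType R).

Definition rademacher_average (S : {fset Y}) : R :=
  (2 ^+ #|` S|)^-1 *
  \sum_(e : {ffun S -> bool}) `|\sum_(s : S) (-1) ^+ e s *: val s|.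

Definition has_type (p : R) : Prop :=
  1 <= p /\
  exists T : R, forall S : {fset Y},
    rademacher_average S <= T * (\sum_(s : S) `|val s| `^ p) `^ p^-1.

Definition nontrivial_type : Prop := exists p : R, 1 < p /\ has_type p.

End RademacherType.

Section Helly.
Context (R : realType) (X : normedModType R).

(* Extended-real valued, so that the distance to the empty set is +oo. *)
Definition dist (x : X) (K : set X) : \bar R :=
  ereal_inf [set (`|x - z|)%:E | z in K].

Definition neighborhood (r : R) (A : set X) : set X :=
  [set x | (dist x A <= r%:E)%E].

(* Only the indices k >= 1 matter: r 0 is junk. *)
Definition Helly_approximation_sequence (r : nat -> R) : Prop :=
  forall k : nat, (0 < k)%N ->
  forall F : set (set X), finite_set F ->
    (forall C, F C -> convex_set (C : set (convex_lmodType X))) ->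
    (forall G : 'I_k -> set X, (forall i, F (G i)) ->
       (@unit_ball R X `&` \bigcap_i G i) !=set0) ->
    (\bigcap_(C in F) neighborhood (r k) C) !=set0.

Definition Helly_approximation_property : Prop :=
  exists2 r : nat -> R, Helly_approximation_sequence r & r @ \oo --> (0 : R).

End Helly.

(* Main.v *)
From HB Require Import structures.
Require Import Defs.
From mathcomp Require Import all_boot all_order all_algebra finmap.
From mathcomp Require Import all_classical all_reals all_analysis.
From mathcomp Require Import ring lra.

(** Everything is compared with one finite-dimensional property of a normed
    space [Y], [almost_isometric_l1n Y]: for every [n] and [eta > 0] the unit
    ball of [Y] contains [n] vectors all of whose [2 ^ n] signed sums have norm
    at least [n - eta].  Such vectors span an almost isometric copy of the
    [n]-dimensional space [l1], and the property is the negation of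
    B-convexity.  The theorem follows from three equivalences.

    Non-trivial type is the absence of almost isometric [l1n]'s (Pisier,
    [nontrivial_typeP]).  If such copies exist, the average of their signed
    sums is at least [n - 1], which no bound of order [n ^ (1/p)] with [p > 1]
    allows.  Conversely, if they are missing for one [N], convexity alone
    improves the trivial estimate [N * sum |x_i| ^ 2] of the mean square of
    [N]-term signed sums by a factor [1 - kappa] ([second_moment_gap]).  This
    gain is propagated to all finite families by induction on their size: a
    few large vectors are set aside, the others are distributed into [N] blocks
    of nearly equal weight, and the improved estimate is applied to the block
    sums ([l2_type_of_gap]).

    The property passes between [X] and its dual [X*] ([l1n_dualP]).  Index an
    [l1n] by the sign vectors [s] on a finite set [I]; for each [i] in [I] the
    signs [s i] give one signed sum, and an element that almost norms it takes
    almost the value [(-1) ^ s i] at the [s]-th vector.  These elements, one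
    for each [i], are the [l1] vectors on the other side.

    [X] has the Helly approximation property exactly when [X*] contains no
    almost isometric [l1n].  If [X*] has none, suppose that the
    [r]-neighborhoods of convex sets [C_i] have no common point.  Separating in
    a product of copies of [X] gives functionals [f_i] with sum zero, total
    norm at most one, and sum of [f_i (c_i)] at most [- r] whenever the [c_i]
    are in [C_i] ([separating_functionals]).  Sampling [k] of the normalized
    functionals at random makes their average small, because the expected norm
    of a sum of [k] terms is of order [k ^ h] with [h < 1]
    ([symmetrization]).  Conditional averages of common points in the unit ball
    of the sampled [k]-tuples of sets then produce [c_i] for which the sum is
    not below a multiple of [k ^ (h - 1)] ([sampled_points]).  Conversely, out
    of an [l1n] in [X*] of length [3 k] one makes half-spaces such that any [k]
    of them meet in the unit ball, while their normals have sum zero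
    ([not_l1n_dual_of_Helly]). *)

Set Implicit Arguments.
Unset Strict Implicit.
Unset Printing Implicit Defensive.
Import Order.TTheory GRing.Theory Num.Theory.
Import numFieldNormedType.Exports.

Local Open Scope classical_set_scope.
Local Open Scope ring_scope.

(** * Linear functionals below a sublinear functional *)

Section HahnBanach.
Context (R : realType) (V : lmodType R).
Implicit Types (p q : V -> R) (x y v : V).

Definition sublinear q : Prop :=
  (forall x y, q (x + y) <= q x + q y) /\
  (forall (a : R) x, 0 <= a -> q (a *: x) = a * q x).

Lemma sublinear_of_le q : (forall x y, q (x + y) <= q x + q y) -> q 0 = 0 ->
  (forall (a : R) x, 0 < a -> q (a *: x) <= a * q x) -> sublinear q.
Proof.
move=> qD q0 qZ; split=> // a x; rewrite le_eqVlt => /predU1P[<-|a0].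
  by rewrite scale0r mul0r q0.
apply/eqP; rewrite eq_le qZ//=.
rewrite -ler_pdivlMl//.
have := qZ a^-1 (a *: x); rewrite invr_gt0 scalerA mulVf ?gt_eqF// scale1r => h.
exact: h.
Qed.

Lemma sublinear0 q : sublinear q -> q 0 = 0.
Proof. by move=> [_ qZ]; rewrite -(scale0r 0) qZ// mul0r. Qed.

Lemma sublinear_geN q x : sublinear q -> - q (- x) <= q x.
Proof.
move=> sq; have [qD _] := sq; have := qD x (- x).
by rewrite subrr (sublinear0 sq) -lerBlDr sub0r.
Qed.

(** The relation [P] is a convex cone of pairs (vector, value).  If [a <= q v]
    for every pair in it, this is the largest sublinear functional below [q]
    that is at most [- a] at each [- v]: it is the way to impose
    lower bounds on a linear functional that is to be dominated by [q]. *)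
Definition descent q (P : V -> R -> Prop) x : R :=
  inf [set q (x + z.1) - z.2 | z in [set z : V * R | P z.1 z.2]].

Section Descent.
Variables (q : V -> R) (P : V -> R -> Prop).
Hypothesis sq : sublinear q.
Hypothesis P0 : P 0 0.
Hypothesis PD : forall v a w b, P v a -> P w b -> P (v + w) (a + b).
Hypothesis PZ : forall (c : R) v a, 0 < c -> P v a -> P (c *: v) (c * a).
Hypothesis Pq : forall v a, P v a -> a <= q v.

Lemma descent_le x v a : P v a -> descent q P x <= q (x + v) - a.
Proof.
move=> Pva; apply: ge_inf; last by exists (v, a).
exists (- q (- x)) => _ [[w b] /= Pwb <-].
rewrite lerBrDl -lerBrDr opprK.
apply: le_trans (Pq Pwb) _; have [qD _] := sq.
by rewrite -{1}(addKr x w) addrC.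
Qed.

Lemma le_descent x c :
  (forall v a, P v a -> c <= q (x + v) - a) -> c <= descent q P x.
Proof.
move=> h; apply: lb_le_inf; first by exists (q (x + 0) - 0), (0, 0).
by move=> _ [[v a] /= Pva <-]; exact: h.
Qed.

Lemma sublinear_descent : sublinear (descent q P).
Proof.
have [qD qZ] := sq; apply: sublinear_of_le.
- move=> x y; rewrite -lerBlDl; apply: le_descent => v a Pva.
  rewrite lerBlDl -lerBlDr; apply: le_descent => w b Pwb.
  rewrite lerBlDr; apply: le_trans (descent_le _ (PD Pwb Pva)) _.
  by have := qD (x + w) (y + v); rewrite addrACA; lra.
- apply/eqP; rewrite eq_le; apply/andP; split.
    have := descent_le 0 P0; rewrite addr0 subr0 (sublinear0 sq); exact.
  by apply: le_descent => v a /Pq; rewrite add0r subr_ge0.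
- move=> a x a0; rewrite -ler_pdivrMl//; apply: le_descent => v b Pvb.
  rewrite ler_pdivrMl//; apply: le_trans (descent_le _ (PZ a0 Pvb)) _.
  by rewrite -scalerDr qZ ?(ltW a0)// mulrBr.
Qed.

End Descent.

(** The descent along the ray of [(y, q y)] is sublinear and below [q], hence
    equal to [q] when [q] is minimal, and it is at most [- q y] at [- y]. *)
Lemma minimal_sublinear_odd q : sublinear q ->
  (forall q', sublinear q' -> (forall x, q' x <= q x) -> q' = q) ->
  forall y, q (- y) = - q y.
Proof.
move=> sq qmin y.
pose P v a := exists2 t, 0 <= t & v = t *: y /\ a = t * q y.
have P0 : P 0 0 by exists 0; rewrite ?scale0r ?mul0r.
have PD v a w b : P v a -> P w b -> P (v + w) (a + b).
  move=> [t t0 [-> ->]] [s s0 [-> ->]]; exists (t + s); first exact: addr_ge0.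
  by rewrite scalerDl mulrDl.
have PZ (c : R) v a : 0 < c -> P v a -> P (c *: v) (c * a).
  move=> c0 [t t0 [-> ->]]; exists (c * t); first by rewrite mulr_ge0// ltW.
  by rewrite scalerA mulrA.
have Pq v a : P v a -> a <= q v.
  by have [_ qZ] := sq; move=> [t t0 [-> ->]]; rewrite qZ.
have <- : descent q P (- y) = q (- y).
  congr (_ (- y)); apply: qmin; first exact: sublinear_descent.
  by move=> x; have := descent_le sq Pq x P0; rewrite addr0 subr0.
apply/eqP; rewrite eq_le; apply/andP; split.
  have P1 : P y (q y) by exists 1; rewrite ?scale1r ?mul1r.
  by have := descent_le sq Pq (- y) P1; rewrite addNr (sublinear0 sq) sub0r.
have := sublinear_geN (- y) (sublinear_descent sq P0 PD PZ Pq).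
rewrite (opprK y) => h; apply: le_trans h; rewrite lerN2.
by have := descent_le sq Pq y P0; rewrite addr0 subr0.
Qed.

(** Zorn's lemma for the reverse pointwise order.  The infimum of a chain is
    subadditive because two members can be compared, so that the smaller one
    serves in both terms. *)
Lemma minimal_sublinear_exists p : sublinear p ->
  exists q, [/\ sublinear q, forall x, q x <= p x &
    forall q', sublinear q' -> (forall x, q' x <= q x) -> q' = q].
Proof.
move=> sp.
pose T := {q : V -> R | sublinear q /\ forall x, q x <= p x}.
pose ge (q1 q2 : T) := `[< forall x, sval q2 x <= sval q1 x >].
have [||||t tmax] := @Zorn T ge.
- by move=> t; apply/asboolP.
- move=> r s t /asboolP rs /asboolP st; apply/asboolP => x.
  exact: le_trans (st x) (rs x).
- move=> [s ss] [t st] /asboolP /= h1 /asboolP /= h2.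
  by apply: eq_exist; apply/funext => x; apply/eqP; rewrite eq_le h1 h2.
- move=> A Atot; have [[t0 At0]|A0] := pselect (A !=set0); last first.
    exists (exist _ p (conj sp (fun x => lexx _))) => s As.
    by exfalso; apply: A0; exists s.
  have [m mle mge] : exists2 m : V -> R,
      (forall x t, A t -> m x <= sval t x) &
      (forall x (c : R), (forall t, A t -> c <= sval t x) -> c <= m x).
    exists (fun x => inf [set sval t x | t in A]) => [x t At|x c h].
      apply: ge_inf; last by exists t.
      exists (- p (- x)) => _ [[s [ss sle]] /= As <-].
      by apply: le_trans (sublinear_geN x ss); rewrite lerN2.
    apply: lb_le_inf; first by exists (sval t0 x), t0.
    by move=> _ [t At <-]; exact: h.
  have sm : sublinear m.
    apply: sublinear_of_le.
    + move=> x y; rewrite -lerBlDl; apply: (mge) => s As.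
      rewrite lerBlDl -lerBlDr; apply: (mge) => t At; rewrite lerBlDr.
      have [/asboolP st|/asboolP ts] := Atot _ _ As At.
      * apply: le_trans (mle _ _ At) _; have [[sD _] _] := svalP t.
        by apply: le_trans (sD _ _) _; rewrite lerD2l.
      * apply: le_trans (mle _ _ As) _; have [[sD _] _] := svalP s.
        by apply: le_trans (sD _ _) _; rewrite lerD2r.
    + apply/eqP; rewrite eq_le; apply/andP; split.
        apply: le_trans (mle _ _ At0) _.
        by have [/sublinear0-> _] := svalP t0.
      by apply: (mge) => t At; have [/sublinear0-> _] := svalP t.
    + move=> a x a0; rewrite -ler_pdivrMl//; apply: (mge) => t At.
      rewrite ler_pdivrMl//; apply: le_trans (mle _ _ At) _.
      by have [[_ sZ] _] := svalP t; rewrite sZ// ltW.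
  have mp x : m x <= p x.
    by apply: le_trans (mle _ _ At0) _; have [_] := svalP t0; apply.
  exists (exist _ m (conj sm mp)) => s As; apply/asboolP => x /=.
  exact: mle.
have [st tle] := svalP t.
exists (sval t); split=> // q' sq' q'le.
have q'p x : q' x <= p x by exact: le_trans (tle x).
by have /(congr1 sval) := tmax (exist _ q' (conj sq' q'p)) (introT (asboolP _) q'le).
Qed.

Theorem sublinear_dominates_linear p : sublinear p ->
  exists f : {linear V -> R^o}, forall x, f x <= p x.
Proof.
move=> /minimal_sublinear_exists[q [sq qp qmin]].
have qN := minimal_sublinear_odd sq qmin; have [qD qZ] := sq.
have qDE x y : q (x + y) = q x + q y.
  apply/eqP; rewrite eq_le qD/=.
  by have := qD (x + y) (- y); rewrite addrK qN lerBrDr.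
have ql : linear (q : V -> R^o).
  move=> a x y; rewrite qDE; congr (_ + _).
  have [a0|a0] := leP 0 a; first exact: qZ.
  by rewrite -(opprK a) scaleNr qN qZ ?oppr_ge0 ?ltW// scaleNr.
pose f : {linear V -> R^o} :=
  HB.pack (q : V -> R^o) (GRing.isLinear.Build _ _ _ _ _ ql).
by exists f.
Qed.

(** The existence of a functional dominated by the descent of [q] along the
    cone over [D] with values [t * r] expresses both requirements at once. *)
Theorem convex_separation q (D : set V) (r : R) : sublinear q ->
  (forall d e a, D d -> D e -> 0 <= a <= 1 -> D (a *: d + (1 - a) *: e)) ->
  (forall d, D d -> r <= q d) ->
  exists2 f : {linear V -> R^o}, (forall x, f x <= q x) & forall d, D d -> r <= f d.
Proof.
move=> sq Dconv rD.
have [[d0 Dd0]|D0] := pselect (D !=set0); last first.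
  have [f fq] := sublinear_dominates_linear sq.
  by exists f => // d Dd; exfalso; apply: D0; exists d.
pose P v a := exists t d, [/\ 0 <= t, D d, v = t *: d & a = t * r].
have P0 : P 0 0 by exists 0, d0; rewrite scale0r mul0r.
have PD v a w b : P v a -> P w b -> P (v + w) (a + b).
  move=> [t [d [t0 Dd -> ->]]] [s [e [s0 De -> ->]]].
  have [ts0|ts0] := eqVneq (t + s) 0.
    have [-> ->] : t = 0 /\ s = 0 by lra.
    by rewrite !scale0r !mul0r !addr0.
  have tsp : 0 < t + s by rewrite lt_neqAle eq_sym ts0 addr_ge0.
  exists (t + s), ((t / (t + s)) *: d + (1 - t / (t + s)) *: e); split.
  - exact: ltW.
  - apply: Dconv => //; rewrite divr_ge0 ?(ltW tsp)//=.
    by rewrite ler_pdivrMr// mul1r lerDl.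
  - rewrite scalerDr !scalerA; congr (_ *: _ + _ *: _); field => //.
  - by rewrite mulrDl.
have PZ (c : R) v a : 0 < c -> P v a -> P (c *: v) (c * a).
  move=> c0 [t [d [t0 Dd -> ->]]]; exists (c * t), d.
  by rewrite scalerA mulrA mulr_ge0// ltW.
have Pq v a : P v a -> a <= q v.
  have [_ qZ] := sq; move=> [t [d [t0 Dd -> ->]]].
  by rewrite qZ// ler_wpM2l// rD.
have [f fq] := sublinear_dominates_linear (sublinear_descent sq P0 PD PZ Pq).
exists f => [x|d Dd].
  apply: le_trans (fq x) _.
  by have := descent_le sq Pq x P0; rewrite addr0 subr0.
have Pd : P d r by exists 1, d; rewrite scale1r mul1r.
rewrite -lerN2 -raddfN; apply: le_trans (fq _) _.
by have := descent_le sq Pq (- d) Pd; rewrite addNr (sublinear0 sq) sub0r.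
Qed.

End HahnBanach.

(** * Means over a finite set and over sign vectors *)

Section Mean.
Context (R : realType).

Definition mean (T : finType) (F : T -> R) : R := #|T|%:R^-1 * \sum_t F t.

Lemma mean_le (T : finType) (F G : T -> R) :
  (forall t, F t <= G t) -> mean F <= mean G.
Proof. by move=> FG; rewrite ler_wpM2l ?invr_ge0// ler_sum. Qed.

Lemma mean_ge0 (T : finType) (F : T -> R) : (forall t, 0 <= F t) -> 0 <= mean F.
Proof. by move=> F0; rewrite mulr_ge0 ?invr_ge0// sumr_ge0. Qed.

Lemma mean_cst (T : finType) (c : R) : (0 < #|T|)%N -> mean (fun _ : T => c) = c.
Proof.
move=> T0; rewrite /mean sumr_const -[c *+ _]mulr_natl mulrA mulVf ?mul1r//.
by rewrite pnatr_eq0 -lt0n.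
Qed.

Lemma eq_mean (T : finType) (F G : T -> R) : F =1 G -> mean F = mean G.
Proof. by move=> FG; rewrite /mean (eq_bigr _ (fun t _ => FG t)). Qed.

Lemma mean_eq0 (T : finType) (F : T -> R) : F =1 (fun=> 0) -> mean F = 0.
Proof. by move=> F0; rewrite /mean big1 ?mulr0. Qed.

Lemma meanD (T : finType) (F G : T -> R) :
  mean (fun t => F t + G t) = mean F + mean G.
Proof. by rewrite /mean big_split mulrDr. Qed.

Lemma meanZ (T : finType) (c : R) (F : T -> R) :
  mean (fun t => c * F t) = c * mean F.
Proof. by rewrite /mean -mulr_sumr mulrCA. Qed.

Lemma mean_sum (T I : finType) (F : I -> T -> R) :
  mean (fun t => \sum_i F i t) = \sum_i mean (F i).
Proof. by rewrite /mean exchange_big mulr_sumr. Qed.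

Lemma mean_exchange (T U : finType) (F : T -> U -> R) :
  mean (fun t => mean (F t)) = mean (fun u => mean (F^~ u)).
Proof.
by rewrite /mean -!mulr_sumr exchange_big !mulrA; congr (_ * _); rewrite mulrC.
Qed.

Lemma mean_bij (T : finType) (F : T -> R) (s : T -> T) :
  bijective s -> mean (fun t => F (s t)) = mean F.
Proof. by move=> bs; rewrite /mean [in RHS](reindex s)//; exact: onW_bij. Qed.

Lemma sqr_mean_le (T : finType) (F : T -> R) : (0 < #|T|)%N ->
  mean F ^+ 2 <= mean (fun t => F t ^+ 2).
Proof.
move=> T0; set m := mean F.
have : 0 <= mean (fun t => (F t ^+ 2 + (- (2 * m)) * F t) + m ^+ 2).
  by apply: mean_ge0 => t; rewrite [leRHS](_ : _ = (F t - m) ^+ 2) ?sqr_ge0//; ring.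
by rewrite !meanD meanZ mean_cst// -/m; nra.
Qed.

End Mean.

Section Signs.
Context (R : realType) (Y : normedModType R).

Lemma card_signs_gt0 (I : finType) : (0 < #|{ffun I -> bool}|)%N.
Proof. by rewrite card_ffun card_bool expn_gt0. Qed.

Lemma norm_signZ (b : bool) (y : Y) : `|(-1) ^+ b *: y| = `|y|.
Proof. by rewrite normrZ normr_sign mul1r. Qed.

Lemma norm_sign_sum_le (I : finType) (P : {pred I}) (e : {ffun I -> bool}) (x : I -> Y) :
  `|\sum_(i | P i) (-1) ^+ e i *: x i| <= \sum_(i | P i) `|x i|.
Proof.
apply: le_trans (ler_norm_sum _ _ _) _.
by apply: ler_sum => i _; rewrite norm_signZ.
Qed.

(** Signed sums are enough to express that the [x i] span an almost isometric
    [l1] space: if [|a i| <= 1] with equality somewhere, replacing signs by the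
    [a i] lowers the norm of the sum by at most the sum of the [1 - |a i|].
    Arbitrary index types spare the reindexing when the vectors are labelled
    by sign vectors. *)
Definition almost_isometric_l1n : Prop :=
  forall (I : finType) (eta : R), 0 < eta -> exists x : I -> Y,
    (forall i, `|x i| <= 1) /\
    forall e : {ffun I -> bool}, #|I|%:R - eta <= `|\sum_i (-1) ^+ e i *: x i|.

(** The defect in the Cauchy-Schwarz inequality for a sum is [N] times the sum
    of the squared deviations from the mean; a single one of them is kept. *)
Lemma sqr_sum_le_gap (I : finType) (a : I -> R) (i0 : I) :
  #|I|%:R * (a i0 - (\sum_i a i) / #|I|%:R) ^+ 2 <=
  #|I|%:R * (\sum_i a i ^+ 2) - (\sum_i a i) ^+ 2.
Proof.
set N := #|I|%:R; set s := \sum_i a i.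
have N0 : 0 < N by rewrite ltr0n; apply/card_gt0P; exists i0.
have -> : N * (\sum_i a i ^+ 2) - s ^+ 2 = N * \sum_i (a i - s / N) ^+ 2.
  have -> : \sum_i (a i - s / N) ^+ 2 =
      \sum_i (a i ^+ 2 + (- (2 * (s / N)) * a i + (s / N) ^+ 2)).
    by apply: eq_bigr => i _; ring.
  rewrite !big_split/= -mulr_sumr sumr_const -/s -[_ *+ #|_|]mulr_natl -/N.
  by field; rewrite gt_eqF.
rewrite ler_wpM2l ?(ltW N0)// (bigD1 i0)//= lerDl.
by apply: sumr_ge0 => i _; exact: sqr_ge0.
Qed.

(** Let [m] be the largest norm and [s] the sum of the norms.  If [s] is well
    below [N * m], the norms are spread out and Cauchy-Schwarz already has the
    required defect.  Otherwise the signed sum provided by the hypothesis for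
    the vectors [x i / m] has norm well below [s], and this one term of the
    mean, of weight [M^-1], yields the gain. *)
Lemma second_moment_gap (I : finType) (eta : R) : 0 < eta ->
  (forall x : I -> Y, (forall i, `|x i| <= 1) ->
    exists e : {ffun I -> bool}, `|\sum_i (-1) ^+ e i *: x i| < #|I|%:R - eta) ->
  exists2 kappa : R, 0 < kappa <= 1 & forall x : I -> Y,
    mean (fun e : {ffun I -> bool} => `|\sum_i (-1) ^+ e i *: x i| ^+ 2) <=
    #|I|%:R * (1 - kappa) * \sum_i `|x i| ^+ 2.
Proof.
move=> eta0 gap.
have etaN : eta < #|I|%:R.
  have [|e] := gap (fun=> 0); first by move=> i; rewrite normr0.
  by move=> /(le_lt_trans (normr_ge0 _)); rewrite subr_gt0.
have I0 : (0 < #|I|)%N by rewrite -(ltr0n R); apply: lt_trans etaN.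
have N1 : 1 <= #|I|%:R :> R by rewrite ler1n.
have M1 : 1 <= #|{ffun I -> bool}|%:R :> R by rewrite ler1n card_signs_gt0.
set N : R := #|I|%:R in etaN N1 *; set M : R := #|{ffun I -> bool}|%:R in M1.
have N0 : 0 < N by lra.
have M0 : 0 < M by lra.
pose t := eta / N.
have t0 : 0 < t by rewrite divr_gt0.
have t1 : t < 1 by rewrite ltr_pdivrMr// mul1r.
have tN : eta = t * N by rewrite /t divfK// gt_eqF.
(* At most [t ^ 2 / (4 * N)] and [t ^ 2 / (4 * M)], as the two cases require. *)
pose kappa := t ^+ 2 / (4 * (N * M)).
have NM1 : 1 <= N * M by nra.
have kE : kappa * (N * M) = t ^+ 2 / 4.
  by rewrite /kappa; field; rewrite ?gt_eqF//.
have k0 : 0 < kappa by rewrite divr_gt0 ?exprn_gt0// mulr_gt0// mulr_gt0.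
exists kappa; first by rewrite k0/=; nra.
move=> x.
have [i0 _] := card_gt0P I0.
have [im _ immax] := @arg_maxP _ _ I i0 predT (fun i => `|x i|) isT.
set m := `|x im|; have xm i : `|x i| <= m by exact: immax.
have [m0|m0] := eqVneq m 0.
  have x0 i : x i = 0 by apply/eqP; rewrite -normr_le0 -m0 xm.
  rewrite big1 => [|i _]; last by rewrite x0 normr0 expr0n.
  rewrite mulr0 mean_eq0// => e; rewrite big1 ?normr0 ?expr0n// => i _.
  by rewrite x0 scaler0.
have mp : 0 < m by rewrite lt_neqAle eq_sym m0 normr_ge0.
have [|e0 e0lt] := gap (fun i => m^-1 *: x i).
  by move=> i; rewrite normrZ normfV normr_id ler_pdivrMl// mulr1.
have {}e0lt : `|\sum_i (-1) ^+ e0 i *: x i| <= (N - eta) * m.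
  have e0E : \sum_i (-1) ^+ e0 i *: (m^-1 *: x i) =
      m^-1 *: \sum_i (-1) ^+ e0 i *: x i.
    by rewrite scaler_sumr; apply: eq_bigr => i _; rewrite !scalerA mulrC.
  move: e0lt; rewrite e0E normrZ normfV normr_id ltr_pdivrMl// mulrC.
  exact: ltW.
pose a i := `|x i|; set s := \sum_i a i; set q := \sum_i a i ^+ 2.
have s0 : 0 <= s by apply: sumr_ge0 => i _; exact: normr_ge0.
have Fs (e : {ffun I -> bool}) : `|\sum_i (-1) ^+ e i *: x i| <= s by exact: norm_sign_sum_le.
have Fs2 (e : {ffun I -> bool}) : `|\sum_i (-1) ^+ e i *: x i| ^+ 2 <= s ^+ 2.
  by rewrite lerXn2r ?nnegrE ?normr_ge0.
have gapq := sqr_sum_le_gap a im; rewrite -/N -/s -/q -[a im]/m /= in gapq.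
have sq : s ^+ 2 <= N * q.
  by have := sqr_ge0 (m - s / N); nra.
have qm : q <= N * m ^+ 2.
  rewrite /N mulr_natl -sumr_const; apply: ler_sum => i _.
  by rewrite lerXn2r ?nnegrE ?normr_ge0// xm.
have q0 : 0 <= q by apply: sumr_ge0 => i _; exact: sqr_ge0.
(* Small sum: the deviation of [m] from [s / N] is at least [t * m / 2]. *)
have [sbig|ssmall] := lerP ((N - eta / 2) * m) s; last first.
  apply: le_trans (mean_le Fs2) _; rewrite mean_cst ?card_signs_gt0//.
  have : N * (t * m / 2) ^+ 2 <= N * (m - s / N) ^+ 2.
    rewrite ler_pM2l// lerXn2r ?nnegrE//.
    - by rewrite divr_ge0// mulr_ge0// ltW.
    - rewrite subr_ge0 ler_pdivrMr//; nra.
    - rewrite lerBrDr -lerBrDl ler_pdivrMr//; nra.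
  move=> h; have {}h := le_trans h gapq.
  suff : N * kappa * q <= N * (t * m / 2) ^+ 2 by lra.
  have : N * kappa * q <= N * kappa * (N * m ^+ 2).
    by rewrite ler_wpM2l// ltW// mulr_gt0.
  move=> /le_trans; apply.
  rewrite -mulrA ler_pM2l//.
  have -> : (t * m / 2) ^+ 2 = kappa * (N * M) * m ^+ 2 by rewrite kE; field.
  rewrite mulrA ler_wpM2r ?sqr_ge0// ler_pM2l//; nra.
(* Large sum: all terms are at most [s ^ 2], and the one of [e0] is at most
   [((1 - t / 2) * s) ^ 2]. *)
rewrite /mean -/M ler_pdivrMl//.
have : \sum_(e : {ffun I -> bool}) `|\sum_i (-1) ^+ e i *: x i| ^+ 2 <=
    ((N - eta) * m) ^+ 2 + (M - 1) * s ^+ 2.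
  rewrite (bigD1 e0)//=; apply: lerD.
    by rewrite lerXn2r ?nnegrE ?normr_ge0// (le_trans _ e0lt).
  have : \sum_(e | e != e0) `|\sum_i (-1) ^+ e i *: x i| ^+ 2 <= \sum_(e | e != e0) s ^+ 2.
    by apply: ler_sum.
  move=> /le_trans; apply.
  have : \sum_(e : {ffun I -> bool}) s ^+ 2 = M * s ^+ 2.
    by rewrite sumr_const -[_ *+ #|_|]mulr_natl.
  by rewrite (bigD1 e0)//= => h; lra.
move=> /le_trans; apply.
have : ((N - eta) * m) ^+ 2 <= ((1 - t / 2) * s) ^+ 2.
  rewrite lerXn2r ?nnegrE//.
  - by rewrite mulr_ge0 ?ltW// subr_gt0.
  - by rewrite mulr_ge0//; lra.
  - apply: le_trans (_ : (1 - t / 2) * ((N - eta / 2) * m) <= _); last first.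
      by rewrite ler_wpM2l//; lra.
    rewrite mulrA ler_wpM2r ?ltW//; rewrite tN; nra.
move=> h.
have h2 : ((1 - t / 2) * s) ^+ 2 <= (1 - t ^+ 2 / 4) * s ^+ 2.
  rewrite exprMn ler_wpM2r ?sqr_ge0//; nra.
have h3 : M * kappa * s ^+ 2 <= t ^+ 2 / 4 * s ^+ 2.
  rewrite ler_wpM2r ?sqr_ge0// -kE; nra.
have h4 : M * (1 - kappa) * s ^+ 2 <= M * (1 - kappa) * (N * q).
  rewrite ler_wpM2l// mulr_ge0 ?(ltW M0)// subr_ge0; nra.
by lra.
Qed.

End Signs.

(** * From missing almost isometric copies of l1 to type *)

Section Blocks.
Context (R : realType) (Y : normedModType R).

(** Each item goes to a currently least loaded bin, whose load is at most the
    average one. *)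
Lemma balanced_assignment (I J : finType) (w : J -> R) (tau : R) (r : seq J) :
  (0 < #|I|)%N -> 0 <= tau -> uniq r -> (forall j, 0 <= w j) -> (forall j, j \in r -> w j <= tau) ->
  exists c : J -> I, forall i,
    \sum_(j <- r | c j == i) w j <= (\sum_(j <- r) w j) / #|I|%:R + tau.
Proof.
move=> I0 tau0 + w0; have [i0 _] := card_gt0P I0.
elim: r => [_ _|j0 r IH /= /andP[j0r ur] wt].
  by exists (fun=> i0) => i; rewrite !big_nil mul0r add0r.
have [|c cP] := IH ur; first by move=> j jr; apply: wt; rewrite in_cons jr orbT.
pose load i := \sum_(j <- r | c j == i) w j.
have [i1 _ i1min] := @arg_minP _ _ I i0 predT load isT.
have load1 : load i1 <= (\sum_(j <- r) w j) / #|I|%:R.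
  rewrite ler_pdivlMr ?ltr0n// mulr_natr -sumr_const.
  rewrite (partition_big c predT)//=.
  by apply: ler_sum => i _; exact: i1min.
have c'r (i : I) : \sum_(j <- r | (if j == j0 then i1 else c j) == i) w j = load i.
  rewrite big_seq_cond [RHS]big_seq_cond; apply: eq_bigl => j.
  by case: (eqVneq j j0) => [->|//]; rewrite (negbTE j0r).
exists (fun j => if j == j0 then i1 else c j) => i.
rewrite !big_cons eqxx c'r mulrDl -addrA.
have w0N : 0 <= w j0 / #|I|%:R by rewrite divr_ge0.
case: (eqVneq i1 i) => [<-|_].
  apply: le_trans (_ : tau + (\sum_(j <- r) w j) / #|I|%:R <= _).
    by rewrite lerD// wt// mem_head.
  by lra.
by apply: le_trans (cP i) _; rewrite lerDr.
Qed.

(** Multiplying the signs inside each block by an independent sign of the block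
    does not change the mean.  For fixed inner signs, the mean over the block
    signs is the quantity that the hypothesis bounds. *)
Lemma mean_sign_blocks (I J : finType) (A : {pred J}) (x : J -> Y) (c : J -> I) (C : R) :
  (forall y : I -> Y, mean (fun d : {ffun I -> bool} =>
     `|\sum_i (-1) ^+ d i *: y i| ^+ 2) <= C * \sum_i `|y i| ^+ 2) ->
  mean (fun e : {ffun J -> bool} => `|\sum_(j in A) (-1) ^+ e j *: x j| ^+ 2) <=
  C * \sum_i mean (fun e : {ffun J -> bool} =>
     `|\sum_(j in A | c j == i) (-1) ^+ e j *: x j| ^+ 2).
Proof.
move=> hC; set F := (X in mean X <= _).
pose twist (d : {ffun I -> bool}) (e : {ffun J -> bool}) : {ffun J -> bool} :=
  [ffun j => e j (+) d (c j)].
have twistK d : involutive (twist d).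
  by move=> e; apply/ffunP => j; rewrite !ffunE -addbA addbb addbF.
have -> : mean F = mean (fun d => mean (fun e => F (twist d e))).
  rewrite [RHS](_ : _ = mean (fun _ : {ffun I -> bool} => mean F)).
    by rewrite mean_cst// card_signs_gt0.
  by apply: eq_mean => d; apply: mean_bij; exact/inv_bij/twistK.
rewrite mean_exchange -mean_sum -meanZ; apply: mean_le => e.
apply: le_trans (hC _); rewrite le_eqVlt; apply/orP; left; apply/eqP.
apply: eq_mean => d; rewrite /F; congr (`|_| ^+ 2).
rewrite (partition_big c predT)//=; apply: eq_bigr => i _.
rewrite scaler_sumr; apply: eq_bigr => j /andP[_ /eqP <-].
by rewrite scalerA ffunE signr_addb mulrC.
Qed.

Lemma exponent_exists (kappa : R) (N : nat) : (0 < N)%N -> 0 < kappa <= 1 ->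
  exists2 h : R, 0 < h < 1 & N%:R `^ (1 - h) <= 1 + kappa.
Proof.
move=> N0 /andP[k0 k1].
have NR : 1 <= N%:R :> R by rewrite ler1n.
have Np : 0 < N%:R :> R by rewrite ltr0n.
pose d : R := ln (1 + kappa / 4) / N%:R.
have lk : ln (1 + kappa / 4) <= kappa / 4 by apply: le_ln1Dx; lra.
have l0 : 0 < ln (1 + kappa / 4) by apply: ln_gt0; lra.
have d0 : 0 < d by rewrite divr_gt0.
have d1 : d < 1 by rewrite ltr_pdivrMr//; lra.
exists (1 - d); first by apply/andP; split; lra.
have -> : 1 - (1 - d) = d by ring.
rewrite /powR gt_eqF//.
have : d * ln N%:R <= ln (1 + kappa / 4).
  rewrite /d mulrAC ler_pdivrMr// ler_pM2l//.
  apply: le_trans (_ : N%:R - 1 <= _); last by lra.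
  by have := @le_ln1Dx R (N%:R - 1); rewrite subrKC; apply; lra.
rewrite -ler_expR lnK; last by rewrite posrE; lra.
by move=> /le_trans; apply; lra.
Qed.

End Blocks.

Section TypeFromGap.
Context (R : realType) (Y : normedModType R).

(** For [h = 1] and [eta = 0] the last left-hand side is [1 - kappa].  Passing to
    [h < 1] multiplies it by [(N ^ (1 - h)) ^ 2], and [eta] contributes at most
    the factor [(1 + N * eta) ^ 2]; both are made close enough to 1 for the gain
    [1 - kappa] to survive. *)
Lemma block_constants (N kappa : R) (n : nat) : N = n%:R -> (1 < n)%N ->
  0 < kappa <= 1 -> exists h eta theta : R,
  [/\ 0 < h < 1, 0 < eta, N^-1 + eta < 1, 0 < theta < 1 &
    N * (1 - kappa) * (N * ((N^-1 + eta) `^ h) ^+ 2) <= theta].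
Proof.
move=> NE' n1 /andP[k0 k1].
have N2 : 2 <= N by rewrite NE' ler_nat.
have N0 : 0 < N by lra.
have [h /andP[h0 h1] Nh] : exists2 h : R, 0 < h < 1 & N `^ (1 - h) <= 1 + kappa / 8.
  by rewrite NE'; apply: exponent_exists; [exact: ltnW | apply/andP; split; lra].
pose xi := kappa / 6.
pose eta := xi / N.
have xi0 : 0 < xi by rewrite divr_gt0.
have eta0 : 0 < eta by rewrite divr_gt0.
have etaE : N^-1 + eta = (1 + xi) / N by rewrite mulrDl mul1r.
have frac1 : N^-1 + eta < 1.
  by rewrite etaE ltr_pdivrMr// /xi; lra.
have etap : 0 < N^-1 + eta by rewrite addr_gt0// invr_gt0.
pose theta := 1 - kappa ^+ 2 / 4.
have thetaP : N * (1 - kappa) * (N * ((N^-1 + eta) `^ h) ^+ 2) <= theta.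
  have -> : N * (1 - kappa) * (N * ((N^-1 + eta) `^ h) ^+ 2) =
     (1 - kappa) * (N * (N^-1 + eta) `^ h) ^+ 2 by ring.
  have -> : N * (N^-1 + eta) `^ h = N `^ (1 - h) * (1 + xi) `^ h.
    have NE : N `^ (1 - h) * N `^ h = N.
      by rewrite -powRD ?subrK ?powRr1 ?(gt_eqF N0) ?implybT// ltW.
    have NVE : N^-1 `^ h * N `^ h = 1.
      by rewrite -powRM ?mulVf ?powR1 ?gt_eqF// ?invr_ge0 ltW.
    rewrite etaE powRM ?invr_ge0 ?(ltW N0)//; last by lra.
    rewrite -{1}NE -[RHS]mulr1 -NVE; ring.
  have xih : (1 + xi) `^ h <= 1 + xi.
    rewrite -[leRHS]powRr1; last lra.
    by apply: ler_powR; lra.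
  have b : N `^ (1 - h) * (1 + xi) `^ h <= (1 + kappa / 8) * (1 + xi).
    by apply: ler_pM => //; exact: powR_ge0.
  have b0 : 0 <= N `^ (1 - h) * (1 + xi) `^ h by rewrite mulr_ge0 ?powR_ge0.
  have : (N `^ (1 - h) * (1 + xi) `^ h) ^+ 2 <= ((1 + kappa / 8) * (1 + xi)) ^+ 2.
    by rewrite lerXn2r ?nnegrE// (le_trans b0).
  move=> /(ler_wpM2l (_ : 0 <= 1 - kappa)) /le_trans; apply; first lra.
  have : ((1 + kappa / 8) * (1 + xi)) ^+ 2 <= 1 + kappa.
    have b1 : (1 + kappa / 8) * (1 + xi) <= 1 + 15 / 48 * kappa by rewrite /xi; nra.
    by nra.
  move=> /(ler_wpM2l (_ : 0 <= 1 - kappa)) /le_trans; apply; first lra.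
  rewrite /theta; nra.
have theta1 : theta < 1 by rewrite /theta ltrBlDr ltrDl divr_gt0// exprn_gt0.
have theta0 : 0 < theta by rewrite /theta; nra.
exists h, eta, theta; split=> //; apply/andP; split; lra.
Qed.

(** Write [w j] for [|x j| ^ (1/h)] and [phi] for the total weight.  Vectors of
    weight above [eta * phi] contribute at most [phi ^ h / eta].  The others
    are distributed into [N] blocks of weight at most [(1/N + eta) * phi], less
    than [phi], so that the blocks are proper subfamilies and the induction
    hypothesis holds for them; the estimate for [N] vectors then bounds their
    sum by [theta * K * phi ^ (2 h)].  As [theta < 1], the two contributions
    fit below [K * phi ^ (2 h)] when [K] is large enough. *)
Lemma l2_type_of_gap (I : finType) (kappa : R) : (1 < #|I|)%N -> 0 < kappa <= 1 ->
  (forall x : I -> Y,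
    mean (fun e : {ffun I -> bool} => `|\sum_i (-1) ^+ e i *: x i| ^+ 2) <=
    #|I|%:R * (1 - kappa) * \sum_i `|x i| ^+ 2) ->
  exists K h : R, [/\ 0 <= K, 0 < h < 1 &
    forall (J : finType) (x : J -> Y),
      mean (fun e : {ffun J -> bool} => `|\sum_j (-1) ^+ e j *: x j| ^+ 2) <=
      K * ((\sum_j `|x j| `^ h^-1) `^ h) ^+ 2].
Proof.
move=> I1 k01 gap; have /andP[k0 k1] := k01.
have I0 : (0 < #|I|)%N by exact: ltnW.
have N2 : 2 <= #|I|%:R :> R by rewrite ler_nat.
set N : R := #|I|%:R in gap N2.
have N0 : 0 < N by lra.
have [h [eta [theta [/andP[h0 h1] eta0 frac1 /andP[theta0 theta1] thetaP]]]] :=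
  block_constants erefl I1 k01; rewrite -/N in frac1 thetaP.
have etap : 0 < N^-1 + eta by rewrite addr_gt0// invr_gt0.
pose theta' := (1 + theta) / 2.
(* The weight in [(a + b) ^ 2 <= (1 + t^-1) * a ^ 2 + (1 + t) * b ^ 2]. *)
pose t := (theta' - theta) / theta.
have t0 : 0 < t by rewrite divr_gt0// /theta'; lra.
have tE : (1 + t) * theta = theta' by rewrite /t; field; rewrite gt_eqF.
have tV : 0 < t^-1 by rewrite invr_gt0.
have theta'1 : 0 < 1 - theta' by rewrite /theta'; lra.
pose K := (1 + t^-1) * eta^-1 ^+ 2 / (1 - theta').
have K0 : 0 <= K.
  apply: divr_ge0; last exact: ltW.
  by apply: mulr_ge0; [lra | exact: sqr_ge0].
have KE : (1 + t^-1) * eta^-1 ^+ 2 + theta' * K = K.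
  by rewrite /K; field; rewrite !gt_eqF.
clearbody K theta' t.
exists K, h; split=> //; first by rewrite h0.
move=> J x; pose w j := `|x j| `^ h^-1.
have w0 j : 0 <= w j by exact: powR_ge0.
have wh j : w j `^ h = `|x j| by rewrite -powRrM mulVf ?gt_eqF// powRr1.
(* All families stay indexed by [J], so that they share their signs. *)
suff claim n (A : {set J}) : (#|A| <= n)%N ->
    mean (fun e : {ffun J -> bool} => `|\sum_(j in A) (-1) ^+ e j *: x j| ^+ 2) <=
    K * ((\sum_(j in A) w j) `^ h) ^+ 2.
  have := claim _ [set: J]%SET (leqnn _).
  rewrite (eq_bigl xpredT); last by move=> j; rewrite inE.
  apply: le_trans; rewrite le_eqVlt; apply/orP; left; apply/eqP; congr mean.
  by apply/funext => e; congr (`|_| ^+ 2); apply: eq_bigl => j; rewrite inE.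
elim: n A => [A|n IH A An].
  rewrite leqn0 cards_eq0 => /eqP ->.
  rewrite mean_eq0; first by rewrite mulr_ge0 ?sqr_ge0.
  by move=> e; rewrite big_set0 normr0 expr0n.
set phi := \sum_(j in A) w j.
have phi0 : 0 <= phi by apply: sumr_ge0.
have [phiz|phiz] := eqVneq phi 0.
  rewrite mean_eq0; first by rewrite mulr_ge0 ?sqr_ge0.
  move=> e; rewrite big1 ?normr0 ?expr0n// => j jA.
  have wj : w j = 0.
    by move/eqP: phiz; rewrite psumr_eq0// => /allP/(_ j (mem_index_enum _)); rewrite jA => /eqP.
  have /eqP : `|x j| = 0 by rewrite -wh wj powR0// gt_eqF.
  by rewrite normr_eq0 => /eqP->; rewrite scaler0.
have phip : 0 < phi by rewrite lt_neqAle eq_sym phiz.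
pose B := [set j in A | eta * phi < w j]%SET.
pose A' := [set j in A | w j <= eta * phi]%SET.
have splitA (F : J -> Y) : \sum_(j in A) F j = \sum_(j in B) F j + \sum_(j in A') F j.
  rewrite (bigID (fun j => eta * phi < w j))/=; congr (_ + _); apply: eq_bigl => j.
    by rewrite inE.
  by rewrite inE leNgt.
have [c cP] := @balanced_assignment R I J w (eta * phi) (enum A')
  I0 (ltW (mulr_gt0 eta0 phip)) (enum_uniq _) w0
  (fun j => ltac:(by rewrite mem_enum inE => /andP[])).
pose Ai i := [set j in A' | c j == i]%SET.
have phiA' : \sum_(j in A') w j <= phi.
  rewrite /phi [leRHS](bigID (mem A'))/= -[leLHS]addr0 lerD ?sumr_ge0//.
  rewrite le_eqVlt; apply/orP; left; apply/eqP; apply: eq_bigl => j.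
  by rewrite !inE andbA andbb.
have loadP i : \sum_(j in Ai i) w j <= (N^-1 + eta) * phi.
  have := cP i; rewrite big_enum_cond big_enum/= => h'.
  rewrite (eq_bigl (fun j => (j \in A') && (c j == i))); last by move=> j; rewrite inE.
  apply: le_trans h' _; rewrite mulrDl lerD2r mulrC ler_pM2l ?invr_gt0//.
have Ain i : (#|Ai i| <= n)%N.
  rewrite -ltnS; apply: leq_trans An; apply: proper_card.
  rewrite properE; apply/andP; split.
    by apply/fintype.subsetP => j; rewrite !inE => /andP[/andP[]].
  apply/negP => AsAi.
  have : phi <= \sum_(j in Ai i) w j.
    rewrite [leRHS](bigID (mem A))/= -[leLHS]addr0 lerD ?sumr_ge0//.
    rewrite le_eqVlt; apply/orP; left; apply/eqP; apply: eq_bigl => j.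
    by apply/idP/andP => [jA|[]//]; split=> //; exact: (fintype.subsetP AsAi).
  move=> /le_trans/(_ (loadP i)); rewrite leNgt => /negP; apply.
  by rewrite gtr_pMl.
have small : mean (fun e : {ffun J -> bool} => `|\sum_(j in A') (-1) ^+ e j *: x j| ^+ 2) <=
    theta * K * (phi `^ h) ^+ 2.
  apply: le_trans (mean_sign_blocks _ _ c gap) _.
  have : \sum_i mean (fun e : {ffun J -> bool} =>
      `|\sum_(j in A' | c j == i) (-1) ^+ e j *: x j| ^+ 2) <=
      \sum_(i : I) K * (((N^-1 + eta) * phi) `^ h) ^+ 2.
    apply: ler_sum => i _.
    rewrite (@eq_mean _ _ _
        (fun e : {ffun J -> bool} => `|\sum_(j in Ai i) (-1) ^+ e j *: x j| ^+ 2)); last first.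
      by move=> e; congr (`|_| ^+ 2); apply: eq_bigl => j; rewrite [in RHS]inE.
    apply: le_trans (IH _ (Ain i)) _; apply: ler_wpM2l => //.
    rewrite lerXn2r ?nnegrE ?powR_ge0//.
    by apply: (ge0_ler_powR (ltW h0)); rewrite ?nnegrE ?(loadP i) ?sumr_ge0// ltW ?mulr_gt0.
  move=> /(ler_wpM2l (_ : 0 <= N * (1 - kappa))) /le_trans; apply.
    by apply: mulr_ge0; lra.
  rewrite sumr_const -[_ *+ #|I|]mulr_natl -/N powRM ?(ltW etap)//.
  rewrite [leLHS](_ : _ = (N * (1 - kappa) * (N * ((N^-1 + eta) `^ h) ^+ 2)) *
     (K * (phi `^ h) ^+ 2)); last by ring.
  by rewrite -[leRHS]mulrA ler_wpM2r// mulr_ge0// sqr_ge0.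
(* For a large vector the factor [w j / (eta * phi)] is at least 1. *)
have big (e : {ffun J -> bool}) :
    `|\sum_(j in B) (-1) ^+ e j *: x j| <= eta^-1 * phi `^ h.
  apply: le_trans (norm_sign_sum_le _ _ _) _.
  apply: (@le_trans _ _ (\sum_(j in B) phi `^ h * (w j / (eta * phi)))).
    apply: ler_sum => j; rewrite inE => /andP[jA jbig].
    apply: (@le_trans _ _ (phi `^ h)).
      rewrite -wh; apply: (ge0_ler_powR (ltW h0)); rewrite ?nnegrE//.
      by rewrite /phi (bigD1 j)//= lerDl sumr_ge0.
    have big1j : 1 <= w j / (eta * phi).
      by rewrite ler_pdivlMr ?mul1r ?ltW// mulr_gt0.
    by rewrite ler_peMr ?powR_ge0.
  rewrite -mulr_sumr -mulr_suml mulrC ler_wpM2r ?powR_ge0//.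
  rewrite ler_pdivrMr; last exact: mulr_gt0.
  rewrite mulrA mulVf ?gt_eqF// mul1r.
  rewrite /phi [leRHS](bigID (mem B))/= -[leLHS]addr0 lerD ?sumr_ge0//.
  rewrite le_eqVlt; apply/orP; left; apply/eqP; apply: eq_bigl => j.
  by rewrite !inE andbA andbb.
have sqD (a b : R) : (a + b) ^+ 2 <= (1 + t^-1) * a ^+ 2 + (1 + t) * b ^+ 2.
  have : 0 <= t^-1 * (a - t * b) ^+ 2 by rewrite mulr_ge0 ?sqr_ge0// invr_ge0 ltW.
  have -> : t^-1 * (a - t * b) ^+ 2 = t^-1 * a ^+ 2 - 2 * a * b + t * b ^+ 2.
    by field; rewrite gt_eqF.
  by lra.
apply: (@le_trans _ _ (mean (fun e : {ffun J -> bool} =>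
    (1 + t^-1) * (eta^-1 * phi `^ h) ^+ 2 +
    (1 + t) * `|\sum_(j in A') (-1) ^+ e j *: x j| ^+ 2))).
  apply: mean_le => e; rewrite splitA.
  apply: (@le_trans _ _ ((eta^-1 * phi `^ h + `|\sum_(j in A') (-1) ^+ e j *: x j|) ^+ 2)).
    rewrite lerXn2r ?nnegrE ?addr_ge0 ?mulr_ge0 ?powR_ge0 ?invr_ge0 ?(ltW eta0)//.
    by apply: le_trans (ler_normD _ _) _; rewrite lerD2r.
  exact: sqD.
rewrite meanD mean_cst ?card_signs_gt0// meanZ.
have t1 : 0 <= 1 + t by lra.
apply: (@le_trans _ _ ((1 + t^-1) * (eta^-1 * phi `^ h) ^+ 2 +
    (1 + t) * (theta * K * (phi `^ h) ^+ 2))).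
  by rewrite lerD2l ler_wpM2l.
rewrite -[K in leRHS]KE -tE le_eqVlt; apply/orP; left; apply/eqP; ring.
Qed.

End TypeFromGap.

Section TypeVersusL1n.
Context (R : realType) (Y : normedModType R).

(** When the missing copy of [l1] has a single vector, the space is zero. *)
Lemma l2_type_of_not_l1n : ~ almost_isometric_l1n Y ->
  exists K h : R, [/\ 0 <= K, 0 < h < 1 &
    forall (J : finType) (x : J -> Y),
      mean (fun e : {ffun J -> bool} => `|\sum_j (-1) ^+ e j *: x j| ^+ 2) <=
      K * ((\sum_j `|x j| `^ h^-1) `^ h) ^+ 2].
Proof.
move=> /existsNP[I /existsNP[eta /not_implyP[eta0 noI]]].
have gap (x : I -> Y) : (forall i, `|x i| <= 1) ->
    exists e : {ffun I -> bool}, `|\sum_i (-1) ^+ e i *: x i| < #|I|%:R - eta.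
  move=> x1; apply/not_existsP => hx; apply: noI; exists x; split=> // e.
  by rewrite leNgt; apply/negP/hx.
have [kappa k01 hk] := second_moment_gap eta0 gap.
have [I1|] := ltnP 1 #|I|; first exact: l2_type_of_gap I1 k01 hk.
rewrite leq_eqVlt ltnS leqn0 => /predU1P[I1|/eqP I0]; last first.
  have [|e] := gap (fun=> 0); first by move=> i; rewrite normr0.
  move=> /(le_lt_trans (normr_ge0 _)); rewrite I0 sub0r oppr_gt0 => eta0'.
  by have := lt_trans eta0 eta0'; rewrite ltxx.
have Y0 (y : Y) : y = 0.
  have := hk (fun=> y); rewrite I1 mul1r.
  have [i0 iE] := fintype1 I1.
  rewrite (@eq_mean _ _ _ (fun _ : {ffun I -> bool} => `|y| ^+ 2)); last first.
    move=> e; rewrite (bigD1 i0)//= big1 => [|i]; last by rewrite [i]iE eqxx.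
    by rewrite addr0 norm_signZ.
  rewrite mean_cst ?card_signs_gt0// sumr_const I1 mulr1n => hy.
  have /andP[k0 _] := k01.
  have : `|y| ^+ 2 <= 0 by have := sqr_ge0 `|y|; nra.
  by rewrite real_exprn_even_le0// ?normr_real// normr_eq0 => /eqP.
exists 0, 2^-1; split=> //; first by apply/andP; split; lra.
move=> J x; rewrite mul0r mean_eq0// => e.
by rewrite (Y0 (\sum_j _)) normr0 expr0n.
Qed.

Lemma rademacher_averageE (S : {fset Y}) :
  rademacher_average S =
  mean (fun e : {ffun S -> bool} => `|\sum_(s : S) (-1) ^+ e s *: val s|).
Proof.
by rewrite /rademacher_average /mean card_ffun card_bool cardfE natrX.
Qed.

Lemma nontrivial_type_of_not_l1n : ~ almost_isometric_l1n Y -> nontrivial_type Y.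
Proof.
move=> /l2_type_of_not_l1n[K [h [K0 /andP[h0 h1] hK]]].
exists h^-1; split; first by rewrite invf_gt1.
split; first by rewrite ltW// invf_gt1.
exists (Num.sqrt K) => S; rewrite invrK rademacher_averageE.
set F := fun e : {ffun S -> bool} => _.
have F0 e : 0 <= F e by exact: normr_ge0.
rewrite -(@ler_pXn2r _ 2)// ?nnegrE; last 2 first.
- exact: mean_ge0.
- by rewrite mulr_ge0 ?sqrtr_ge0 ?powR_ge0.
apply: le_trans (sqr_mean_le _ (card_signs_gt0 _)) _.
by rewrite exprMn sqr_sqrtr//; exact: hK.
Qed.

Lemma sublinear_growth (T h : R) : h < 1 ->
  exists m : nat, T * m%:R `^ h < m%:R - 1.
Proof.
move=> h1.
pose c := 2 * (`|T| + 1).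
have T0 := normr_ge0 T.
have c1 : 1 < c by rewrite /c; lra.
have c0 : 0 < c by lra.
have k0 : 0 < 1 - h by lra.
pose a := c `^ (1 - h)^-1.
have [m mE] : exists m : nat, a < m%:R by exists (Num.bound a); exact: archi_boundP (powR_ge0 _ _).
exists m.+2.
set M : R := m.+2%:R.
have M2 : 2 <= M by rewrite ler_nat.
have M0 : 0 < M by lra.
have aM : a <= M by apply: ltW (lt_le_trans mE _); rewrite ler_nat leqW.
have cM : c <= M `^ (1 - h).
  have -> : c = a `^ (1 - h) by rewrite -powRrM mulVf ?gt_eqF// powRr1// ltW.
  by apply: (ge0_ler_powR (ltW k0)); rewrite ?nnegrE ?powR_ge0// ltW.
have ME : M = M `^ (1 - h) * M `^ h.
  by rewrite -powRD ?subrK ?powRr1 ?(gt_eqF M0) ?implybT// ltW.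
have Mh0 : 0 < M `^ h by exact: powR_gt0.
have : T * M `^ h <= `|T| * M `^ h by rewrite ler_pM2r// ler_norm.
have : c * M `^ h <= M by rewrite {2}ME ler_pM2r.
by rewrite /c; lra.
Qed.

(** Two equal vectors taken with opposite signs would cancel.  Injectivity
    matters because type is defined by sets, not families, of vectors. *)
Lemma l1n_inj (I : finType) (x : I -> Y) : (forall i, `|x i| <= 1) ->
  (forall e : {ffun I -> bool}, #|I|%:R - 1 <= `|\sum_i (-1) ^+ e i *: x i|) ->
  injective x.
Proof.
move=> x1 xI i j xij; apply/eqP/negPn/negP => ij.
have := xI [ffun k => k == i]; rewrite leNgt => /negP; apply.
rewrite (bigD1 i)//= (bigD1 j) 1?eq_sym//= !ffunE eqxx eq_sym (negbTE ij).
rewrite expr1 scaleN1r expr0 scale1r xij addrA addNr add0r.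
apply: le_lt_trans (norm_sign_sum_le _ _ _) _.
apply: (@le_lt_trans _ _ (\sum_(k | (k != i) && (k != j)) 1)).
  exact: ler_sum.
have : \sum_(k : I) (1 : R) = #|I|%:R by rewrite sumr_const.
by rewrite (bigD1 i)//= (bigD1 j) 1?eq_sym//= => <-; rewrite addrA; lra.
Qed.

Lemma not_l1n_of_nontrivial_type : nontrivial_type Y -> ~ almost_isometric_l1n Y.
Proof.
move=> [p [p1 [_ [T hT]]]] l1.
have p0 : 0 < p by lra.
have [m mT] : exists m : nat, `|T| * m%:R `^ p^-1 < m%:R - 1.
  by apply: sublinear_growth; rewrite invf_lt1.
have [x [x1 xm]] := l1 'I_m 1 ltr01.
have xinj := l1n_inj x1 xm.
rewrite card_ord in xm.
pose S := [fset x i | i in 'I_m]%fset.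
have xS i : x i \in S by apply/imfsetP; exists i.
pose f i : S := [` xS i]%fset.
have fbij : bijective f.
  have /boolp.choice[g gK] : forall s : S, exists i, x i = val s.
    move=> s; have /imfsetP[i _ si] := fsvalP s.
    by exists i; exact/esym.
  exists g => [i|s]; first by apply: xinj; rewrite gK.
  by apply: val_inj; rewrite /= gK.
have fr : {on [pred i | true], bijective f} by exact: onW_bij.
have := hT S; rewrite rademacher_averageE leNgt => /negP; apply.
apply: (@lt_le_trans _ _ (m%:R - 1)); last first.
  rewrite -(@mean_cst R {ffun S -> bool} (m%:R - 1)) ?card_signs_gt0//.
  apply: mean_le => e.
  rewrite (reindex f)//=.
  have := xm [ffun i => e (f i)]; congr (_ <= `|_|).
  by apply: eq_bigr => i _; rewrite ffunE.
apply: le_lt_trans mT.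
have hp : 0 <= p^-1 by rewrite invr_ge0 ltW.
apply: (@le_trans _ _ (`|T| * (\sum_(s : S) `|val s| `^ p) `^ p^-1)).
  by rewrite ler_wpM2r ?powR_ge0 ?ler_norm.
rewrite ler_wpM2l//; apply: (ge0_ler_powR hp); rewrite ?nnegrE//.
  by apply: sumr_ge0 => s _; exact: powR_ge0.
rewrite (reindex f)//= -[m in leRHS]card_ord -sumr_const; apply: ler_sum => i _.
have -> : 1 = 1 `^ p :> R by rewrite powR1.
by apply: (ge0_ler_powR (ltW p0)); rewrite ?nnegrE ?x1.
Qed.

Theorem nontrivial_typeP : nontrivial_type Y <-> ~ almost_isometric_l1n Y.
Proof.
split; [exact: not_l1n_of_nontrivial_type|exact: nontrivial_type_of_not_l1n].
Qed.

End TypeVersusL1n.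

(** * Copies of l1 in a space and in its dual *)

Section DualFacts.
Context (R : realType) (X : normedModType R).
Implicit Types (f : dual X) (x : X).

Lemma dual_sumE (I : finType) (a : I -> R) (f : I -> dual X) x :
  (\sum_i a i *: f i) x = \sum_i a i * f i x.
Proof.
elim/big_rec2 : _ => // i y1 y2 _ <-.
by have -> : (a i *: f i + y2) x = a i * f i x + y2 x by [].
Qed.

Lemma dual_sum_arg (T : Type) (r : seq T) (P : pred T) (a : T -> R) (x : T -> X) f :
  f (\sum_(i <- r | P i) a i *: x i) = \sum_(i <- r | P i) a i * f (x i).
Proof.
elim/big_rec2 : _ => [|i y1 y2 _ <-]; first exact: dual0.
exact: dual_linear.
Qed.

Lemma dualB f x y : f (x - y) = f x - f y.
Proof. by rewrite addrC -scaleN1r dual_linear scaleN1r addrC. Qed.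

Lemma dual_bound f x : `|f x| <= `|f| * `|x|.
Proof.
have [->|x0] := eqVneq x 0; first by rewrite dual0 !normr0 mulr0.
have nx0 : 0 < `|x| by rewrite normr_gt0.
have := @dual_norm_ub R X f (`|x|^-1 *: x).
rewrite normrZ normfV normr_id mulVf ?gt_eqF// lexx => /(_ isT).
by rewrite dualZ normrM normfV normr_id ler_pdivrMl// mulrC.
Qed.

Lemma dual_bound1 f x : `|f| <= 1 -> `|f x| <= `|x|.
Proof.
move=> f1; apply: le_trans (dual_bound f x) _.
by rewrite -[leRHS]mul1r ler_wpM2r.
Qed.

Lemma dual_norm_approx f c : c < `|f| -> exists2 x, `|x| <= 1 & c < f x.
Proof.
move=> cf; apply: contrapT => noX; move: cf; rewrite ltNge => /negP; apply.
apply: dual_norm_le => x x1; rewrite ler_norml lerNl.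
have h y : `|y| <= 1 -> f y <= c.
  by move=> y1; rewrite leNgt; apply/negP => cy; apply: noX; exists y.
rewrite h// andbT -[- f x]mulN1r -dualZ scaleN1r h// normrN//.
Qed.

Lemma dual_of_linear (g : {linear X -> R^o}) (C : R) : 0 <= C ->
  (forall x, g x <= C * `|x|) -> exists2 f : dual X, `|f| <= C & f =1 g.
Proof.
move=> C0 gC.
have gC' x : `|g x| <= C * `|x|.
  by rewrite ler_norml lerNl gC -raddfN -(normrN x) gC.
have gc : continuous g.
  apply: bounded_linear_continuous; apply/linear_boundedP.
  exists C; split=> [|r Cr x]; first exact: num_real.
  by apply: le_trans (gC' x) _; rewrite ler_wpM2r// ltW.
have gin : (g : X -> R^o) \in @functional_pred R X.
  by apply/asboolP; split=> //; exact: linearP.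
exists (Dual gin) => //; apply: dual_norm_le => x x1 /=.
by apply: le_trans (gC' x) _; rewrite ler_piMr.
Qed.

Lemma sublinear_norm : sublinear (fun x : X => `|x|).
Proof.
split=> [x y|a x a0]; first exact: ler_normD.
by rewrite normrZ ger0_norm.
Qed.

Lemma norming_functional x : exists2 f : dual X, `|f| <= 1 & `|x| <= f x.
Proof.
have [|//|g gle gx] := @convex_separation R X _ [set x] `|x| sublinear_norm.
- move=> d e a -> -> _; rewrite /= -scalerDl addrC subrK scale1r//.
- by move=> d ->.
have [|f f1 fg] := @dual_of_linear g 1 ler01; first by move=> y; rewrite mul1r.
by exists f => //; rewrite fg gx.
Qed.

End DualFacts.

Section L1nDuality.
Context (R : realType).

(** The other terms are at most 1, so a single term carries at most the whole
    defect [eta]. *)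
Lemma almost_extremal_term (I : finType) (a : I -> R) (eta : R) :
  (forall i, a i <= 1) -> #|I|%:R - eta <= \sum_i a i ->
  forall i, 1 - eta <= a i.
Proof.
move=> a1 sa i; rewrite (bigD1 i)//= in sa.
have : \sum_(j : I) (1 : R) = #|I|%:R by rewrite sumr_const.
rewrite (bigD1 i)//=.
have : \sum_(j | j != i) a j <= \sum_(j | j != i) 1 by exact: ler_sum.
lra.
Qed.

Lemma sign_mul_le1 (b : bool) (a : R) : `|a| <= 1 -> (-1) ^+ b * a <= 1.
Proof.
by move=> a1; apply: le_trans (ler_norm _) _; rewrite normrM normr_sign mul1r.
Qed.

Variable X : normedModType R.

Lemma sum_ge_card (I : finType) (a : I -> R) (eta : R) : 0 <= eta ->
  (forall i, 1 - eta / (#|I|%:R + 1) <= a i) -> #|I|%:R - eta <= \sum_i a i.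
Proof.
move=> eta0 h; apply: le_trans (_ : \sum_(i : I) (1 - eta / (#|I|%:R + 1)) <= _).
  have n0 : 0 <= #|I|%:R :> R by [].
  rewrite sumrB !sumr_const lerD2l lerN2 -[X in X <= _]mulr_natr.
  by rewrite -mulrA ler_piMr// mulrC ler_pdivrMr; lra.
exact: ler_sum.
Qed.

(** The functional [f i] norms the signed sum of the [x s] with signs [s i], so
    that [f i (x s)] is almost [(-1) ^ s i].  A sum of the [f i] with signs [e]
    is then almost maximal at the vector [x e]. *)
Lemma l1n_dual : almost_isometric_l1n X -> almost_isometric_l1n (dual X).
Proof.
move=> l1 I eta eta0.
pose J := {ffun I -> bool}.
pose eta' := eta / (#|I|%:R + 1).
have eta'0 : 0 < eta' by rewrite divr_gt0// ltr_wpDl.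
have [x [x1 xJ]] := l1 J eta' eta'0.
pose v i := \sum_(s : J) (-1) ^+ s i *: x s.
have /boolp.choice[f fP] : forall i, exists f : dual X, `|f| <= 1 /\ `|v i| <= f (v i).
  by move=> i; have [f f1 fv] := norming_functional (v i); exists f.
have fx i (s : J) : 1 - eta' <= (-1) ^+ s i * f i (x s).
  have [f1 fv] := fP i.
  apply: (@almost_extremal_term J (fun s => (-1) ^+ s i * f i (x s))) => [t|].
    by apply: sign_mul_le1; apply: le_trans (dual_bound1 _ f1) _.
  rewrite -dual_sum_arg; apply: le_trans fv.
  have := xJ [ffun s : J => s i]; rewrite /v.
  by under eq_bigr do rewrite ffunE.
exists f; split=> [i|e]; first by have [] := fP i.
apply: (@le_trans _ _ ((\sum_i (-1) ^+ e i *: f i : dual X) (x e))).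
  by rewrite dual_sumE; apply: sum_ge_card => [|i]; [exact: ltW | exact: fx].
apply: le_trans (ler_norm _) _.
by apply: le_trans (dual_bound _ _) _; rewrite ler_piMr.
Qed.

(** The same argument with the roles exchanged; a functional need not attain its
    norm, and half of [eta'] pays for choosing a point where it almost does. *)
Lemma l1n_predual : almost_isometric_l1n (dual X) -> almost_isometric_l1n X.
Proof.
move=> l1 I eta eta0.
pose J := {ffun I -> bool}.
pose eta' := eta / (#|I|%:R + 1).
have eta'0 : 0 < eta' by rewrite divr_gt0// ltr_wpDl.
have [f [f1 fJ]] := l1 J (eta' / 2) (divr_gt0 eta'0 (ltr0Sn _ _)).
pose v i : dual X := \sum_(s : J) (-1) ^+ s i *: f s.
have /boolp.choice[x xP] : forall i, exists x : X, `|x| <= 1 /\ #|J|%:R - eta' <= v i x.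
  move=> i; have [|x x1 xv] := @dual_norm_approx _ _ (v i) (#|J|%:R - eta').
    have := fJ [ffun s : J => s i]; rewrite /v.
    under eq_bigr do rewrite ffunE.
    by apply: lt_le_trans; lra.
  by exists x; split=> //; exact: ltW.
have fx i (s : J) : 1 - eta' <= (-1) ^+ s i * f s (x i).
  have [x1 xv] := xP i.
  apply: (@almost_extremal_term J (fun s => (-1) ^+ s i * f s (x i))) => [t|].
    by apply: sign_mul_le1; apply: le_trans (dual_bound1 _ (f1 t)) _.
  by rewrite -dual_sumE.
exists x; split=> [i|e]; first by have [] := xP i.
apply: (@le_trans _ _ (f e (\sum_i (-1) ^+ e i *: x i))).
  by rewrite dual_sum_arg; apply: sum_ge_card => [|i]; [exact: ltW | exact: fx].
apply: le_trans (ler_norm _) _; exact: dual_bound1.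
Qed.

Theorem l1n_dualP : almost_isometric_l1n (dual X) <-> almost_isometric_l1n X.
Proof. by split; [exact: l1n_predual | exact: l1n_dual]. Qed.

End L1nDuality.

(** * The Helly approximation property excludes copies of l1 in the dual *)

Section Convex.
Context (R : realType) (X : normedModType R).

Lemma convex_setE (C : set X) : convex_set (C : set (convex_lmodType X)) <->
  forall x y a, C x -> C y -> 0 <= a <= 1 -> C (a *: x + (1 - a) *: y).
Proof.
split=> [cC x y a Cx Cy /andP[a0 a1]|cC x y l].
  by have := cC x y (Itv01 a0 a1); rewrite !inE; apply.
rewrite !inE => Cx Cy; apply: cC => //.
by rewrite ge0 le1.
Qed.

End Convex.

Section HellyNecessity.
Context (R : realType) (X : normedModType R).

Lemma near_dist_lt (x : X) (C : set X) (a b : R) : a < b ->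
  neighborhood a C x -> exists2 z, C z & `|x - z| < b.
Proof.
move=> ab xC; have : (dist x C < b%:E)%E by apply: le_lt_trans xC _; rewrite lte_fin.
by move=> /ereal_inf_lt[_ [z Cz <-]]; rewrite lte_fin; exists z.
Qed.

(** Subtract from almost isometric [l1] vectors [f i] of the dual their average
    and call the result [u i].  These sum to zero, so the half-spaces
    [1/2 <= u i] do not come close to having a common point.  A point of the
    unit ball that almost norms the sum with sign plus on [k] chosen indices
    and minus elsewhere makes the former [f i] at least 1/2 and the latter at
    most -1/2; since there are [3 k] indices their average is at most 0 there,
    and the point is in the [k] chosen half-spaces. *)
Lemma not_l1n_dual_of_Helly :
  Helly_approximation_property X -> ~ almost_isometric_l1n (dual X).
Proof.
move=> [r hr r0] l1.
have [k k0 rk] : exists2 k, (0 < k)%N & r k < 8^-1.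
  have [N _ hN] : \forall k \near \oo, r k < 8^-1 by apply: (cvgr_lt (0 : R)) => //; lra.
  by exists N.+1 => //; apply: hN => /=.
pose M := (3 * k)%N.
have M0 : (0 < M)%N by rewrite muln_gt0.
have MR : 0 < M%:R :> R by rewrite ltr0n.
have [f [f1 fM]] := l1 'I_M (4^-1) ltac:(lra).
rewrite card_ord in fM.
pose u i (x : X) : R := f i x - M%:R^-1 * \sum_j f j x.
have u0 x : \sum_i u i x = 0.
  rewrite sumrB sumr_const card_ord -[X in _ - X]mulr_natl mulrA mulfV ?gt_eqF//.
  by rewrite mul1r subrr.
have uB i x y : u i (x - y) = u i x - u i y.
  rewrite /u dualB (eq_bigr (fun j => f j x - f j y)) => [|j _]; last exact: dualB.
  by rewrite sumrB; ring.
have uL i a b x y : u i (a *: x + b *: y) = a * u i x + b * u i y.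
  have fL (j : 'I_M) : f j (a *: x + b *: y) = a * f j x + b * f j y.
    by rewrite dual_linear dualZ.
  rewrite /u fL (eq_bigr _ (fun j _ => fL j)) big_split/= -!mulr_sumr; ring.
have ule i x : u i x <= 2 * `|x|.
  rewrite /u mulr_natl mulr2n; apply: lerD.
    by apply: le_trans (ler_norm _) _; exact: dual_bound1.
  rewrite -mulrN ler_pdivrMl// -sumrN.
  rewrite -[M in leRHS]card_ord mulr_natl -sumr_const; apply: ler_sum => j _.
  by apply: le_trans (ler_norm _) _; rewrite normrN; exact: dual_bound1.
pose C i : set X := [set x | 2^-1 <= u i x].
have Cconv i : convex_set (C i : set (convex_lmodType X)).
  apply/convex_setE => x y a xC yC /andP[a0 a1]; rewrite /C /= uL.
  have := ler_wpM2l a0 xC; have := @ler_wpM2l _ (1 - a) _ _ _ yC.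
  by rewrite subr_ge0 => /(_ a1); lra.
have [|||y yC] := hr k k0 (range C).
- by apply: finite_image; exact: finite_finset.
- by move=> _ [i _ <-].
- move=> G GC.
  have /boolp.choice[g gP] : forall a, exists i, C i = G a.
    by move=> a; have [i _ <-] := GC a; exists i.
  pose I := [set g a | a in 'I_k]%SET.
  have Ik : (#|I| <= k)%N by rewrite -[leqRHS]card_ord leq_imset_card.
  pose e : {ffun 'I_M -> bool} := [ffun j => j \notin I].
  have [|x x1 xM] := @dual_norm_approx _ _ (\sum_i (-1) ^+ e i *: f i) (M%:R - 2^-1).
    by apply: lt_le_trans (fM e); lra.
  rewrite dual_sumE in xM.
  have fx j : 1 - 2^-1 <= (-1) ^+ e j * f j x.
    apply: (@almost_extremal_term _ 'I_M (fun j => (-1) ^+ e j * f j x)) => [i|].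
      by apply: sign_mul_le1; apply: le_trans (dual_bound1 _ (f1 i)) _.
    by rewrite card_ord ltW.
  have sum_le0 : \sum_j f j x <= 0.
    have h j : f j x <= 3 / 2 * (j \in I)%:R - 2^-1.
      have := fx j; rewrite ffunE; case: (j \in I) => /=.
        move=> _; have : f j x <= 1; last by lra.
        by apply: le_trans (ler_norm _) _; apply: le_trans (dual_bound1 _ (f1 j)) _.
      by rewrite expr1; lra.
    apply: le_trans (ler_sum _ (fun j _ => h j)) _.
    have -> : \sum_j (3 / 2 * (j \in I)%:R - 2^-1) = 3 / 2 * #|I|%:R - 2^-1 *+ M :> R.
      rewrite sumrB sumr_const card_ord -mulr_sumr -sum1_card natr_sum.
      by rewrite [in RHS]big_mkcond; congr (_ * _ - _); apply: eq_bigr => j _; case: ifP.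
    have : #|I|%:R <= k%:R :> R by rewrite ler_nat.
    rewrite -[_ *+ M]mulr_natl /M natrM; lra.
  exists x; split=> // a _; rewrite -gP /C /= /u.
  have := fx (g a); rewrite ffunE imset_f//= expr0 mul1r => fg.
  have : M%:R^-1 * \sum_j f j x <= 0 by rewrite mulr_ge0_le0// invr_ge0.
  by lra.
have upos i : 0 < u i y.
  have [z Cz yz] := near_dist_lt rk (yC _ (imageP C (I : setT i))).
  have := ule i (z - y); rewrite uB distrC.
  by move: Cz; rewrite /C /=; lra.
have : 0 < \sum_i u i y.
  by rewrite (bigD1 (Ordinal M0))//= ltr_pwDl// sumr_ge0// => i _; exact: ltW.
by rewrite u0 ltxx.
Qed.

End HellyNecessity.

(** * Sampling functionals at random *)

Section ConvexSum.
Context (R : realType) (V : lmodType R).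

Lemma convex_sum (D : set V) (p : V) (T : Type) (s : seq T) (P : pred T)
    (w : T -> R) (z : T -> V) :
  (forall x y a, D x -> D y -> 0 <= a <= 1 -> D (a *: x + (1 - a) *: y)) ->
  D p -> (forall t, P t -> 0 <= w t) -> (forall t, P t -> D (z t)) ->
  exists2 y, D y & \sum_(t <- s | P t) w t *: z t = (\sum_(t <- s | P t) w t) *: y.
Proof.
move=> Dconv Dp w0 Dz; elim: s => [|t s [y Dy IH]].
  by exists p => //; rewrite !big_nil scale0r.
rewrite !big_cons; case: ifP => [Pt|_]; last by exists y.
have W0 : 0 <= \sum_(t <- s | P t) w t by exact: sumr_ge0.
rewrite IH; set W := \sum_(t <- s | P t) w t in W0 *.
have wt0 := w0 _ Pt.
have [wW0|wW0] := eqVneq (w t + W) 0.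
  have [-> ->] : w t = 0 /\ W = 0 by lra.
  by exists p => //; rewrite !scale0r !addr0 scale0r.
have wW : 0 < w t + W by rewrite lt_neqAle eq_sym wW0 addr_ge0.
exists ((w t / (w t + W)) *: z t + (1 - w t / (w t + W)) *: y).
  apply: Dconv => //; first exact: Dz.
  by rewrite divr_ge0 ?(ltW wW)//= ler_pdivrMr// mul1r lerDl.
by rewrite scalerDr !scalerA; congr (_ *: _ + _ *: _); field.
Qed.

End ConvexSum.

Section Sampling.
Context (R : realType) (I : finType) (k : nat) (lam : I -> R).
Hypothesis lam0 : forall i, 0 <= lam i.
Hypothesis lam1 : \sum_i lam i = 1.

Definition sample_weight (J : {ffun 'I_k -> I}) : R := \prod_j lam (J j).

Lemma sample_weight_ge0 J : 0 <= sample_weight J.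
Proof. exact: prodr_ge0. Qed.

Lemma sum_sample_weight : \sum_J sample_weight J = 1.
Proof.
by rewrite -(bigA_distr_bigA (fun _ i => lam i)) big1.
Qed.

(** The event that the [j]-th draw is [i] is the product of an indicator in the
    [j]-th coordinate with constants, so the sum still factors. *)
Lemma sample_weight_marginal (j : 'I_k) (i : I) :
  \sum_(J : {ffun 'I_k -> I} | J j == i) sample_weight J = lam i.
Proof.
pose G (l : 'I_k) (a : I) : R := if l == j then (a == i)%:R * lam a else lam a.
transitivity (\sum_(J : {ffun 'I_k -> I}) \prod_l G l (J l)).
  rewrite big_mkcond; apply: eq_bigr => J _.
  rewrite /sample_weight (bigD1 j)//= [RHS](bigD1 j)//= {1}/G eqxx.
  rewrite [X in _ = _ * X](eq_bigr (fun l => lam (J l))); last first.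
    by move=> l lj; rewrite /G (negbTE lj).
  by case: ifP; rewrite ?mul1r ?mul0r.
rewrite -(bigA_distr_bigA G) (bigD1 j)//= [X in _ * X]big1 ?mulr1; last first.
  by move=> l lj; rewrite /G (negbTE lj).
rewrite /G eqxx (bigD1 i)//= eqxx mul1r big1 ?addr0// => a ai.
by rewrite (negbTE ai) mul0r.
Qed.

Lemma sample_mean (V : lmodType R) (u : I -> V) (j : 'I_k) :
  \sum_(J : {ffun 'I_k -> I}) sample_weight J *: u (J j) = \sum_i lam i *: u i.
Proof.
rewrite (partition_big (fun J : {ffun 'I_k -> I} => J j) predT)//=.
apply: eq_bigr => i _; rewrite -(sample_weight_marginal j i) scaler_suml.
by apply: eq_bigr => J /eqP ->.
Qed.

Section Symmetrization.
Variables (Z : normedModType R) (u : I -> Z) (B : R).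
Hypothesis u_mean0 : \sum_i lam i *: u i = 0.
Hypothesis uB : forall J : {ffun 'I_k -> I},
  mean (fun e : {ffun 'I_k -> bool} => `|\sum_j (-1) ^+ e j *: u (J j)|) <= B.

Let S (J : {ffun 'I_k -> I}) : Z := \sum_j u (J j).

Let S_mean0 : \sum_J sample_weight J *: S J = 0.
Proof.
under eq_bigr do rewrite /S scaler_sumr.
by rewrite exchange_big big1//= => j _; rewrite sample_mean.
Qed.

(** Exchanging the coordinates selected by [e] between two independent samples
    preserves their joint law. *)
Let swap (e : {ffun 'I_k -> bool}) (q : {ffun 'I_k -> I} * {ffun 'I_k -> I}) :=
  ([ffun j => if e j then q.2 j else q.1 j],
   [ffun j => if e j then q.1 j else q.2 j]).

Let swapK e : involutive (swap e).
Proof.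
by move=> [J J']; congr pair; apply/ffunP => j; rewrite !ffunE /= ?ffunE; case: (e j).
Qed.

Let swap_weight e q : sample_weight (swap e q).1 * sample_weight (swap e q).2 =
  sample_weight q.1 * sample_weight q.2.
Proof.
rewrite /sample_weight -!big_split; apply: eq_bigr => j _ /=.
by rewrite !ffunE; case: ifP => // _; rewrite mulrC.
Qed.

(** A sum [S J] of centered terms is the mean of [S J - S J'] over an
    independent copy [J'].  In the norm of the latter each coordinate may be
    given an arbitrary sign by [swap], and separating [J] from [J'] again
    costs the factor 2. *)
Lemma symmetrization : \sum_J sample_weight J * `|S J| <= 2 * B.
Proof.
pose W (q : {ffun 'I_k -> I} * {ffun 'I_k -> I}) := sample_weight q.1 * sample_weight q.2.
have W0 q : 0 <= W q by rewrite mulr_ge0// sample_weight_ge0.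
have decouple : \sum_J sample_weight J * `|S J| <= \sum_q W q * `|S q.1 - S q.2|.
  rewrite -(pair_big predT predT (fun J J' => sample_weight J * sample_weight J' * `|S J - S J'|))/=.
  apply: ler_sum => J _; under eq_bigr do rewrite -mulrA.
  rewrite -mulr_sumr ler_wpM2l ?sample_weight_ge0//.
  have SJ : S J = \sum_J' sample_weight J' *: (S J - S J').
    under eq_bigr do rewrite scalerBr.
    by rewrite sumrB S_mean0 subr0 -scaler_suml sum_sample_weight scale1r.
  rewrite [X in `|X| <= _]SJ; apply: le_trans (ler_norm_sum _ _ _) _.
  rewrite le_eqVlt; apply/orP; left; apply/eqP; apply: eq_bigr => J' _.
  by rewrite normrZ ger0_norm ?sample_weight_ge0.
have swapped (e : {ffun 'I_k -> bool}) : \sum_q W q * `|S q.1 - S q.2| <=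
    2 * \sum_J sample_weight J * `|\sum_j (-1) ^+ e j *: u (J j)|.
  pose Se J := \sum_j (-1) ^+ e j *: u (J j).
  rewrite (reindex (swap e))/=; last by apply: onW_bij; exact/inv_bij/swapK.
  have -> : \sum_q W (swap e q) * `|S (swap e q).1 - S (swap e q).2| =
            \sum_q W q * `|Se q.1 - Se q.2|.
    apply: eq_bigr => q _; rewrite /W swap_weight; congr (_ * `|_|).
    rewrite /S /Se -!sumrB; apply: eq_bigr => j _.
    rewrite -scalerBr !ffunE; case: (e j) => /=; last by rewrite scale1r.
    by rewrite expr1 scaleN1r opprB.
  apply: (@le_trans _ _ (\sum_q (W q * `|Se q.1| + W q * `|Se q.2|))).
    by apply: ler_sum => q _; rewrite -mulrDr ler_wpM2l// ler_normB.
  rewrite big_split/= mulr_natl mulr2n le_eqVlt; apply/orP; left; apply/eqP.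
  congr (_ + _).
    rewrite -(pair_big predT predT (fun J J' => sample_weight J * sample_weight J' * `|Se J|))/=.
    apply: eq_bigr => J _; rewrite -mulr_suml -mulr_sumr.
    by rewrite sum_sample_weight mulr1.
  rewrite -(pair_big predT predT (fun J J' => sample_weight J * sample_weight J' * `|Se J'|))/=.
  rewrite exchange_big/=; apply: eq_bigr => J _; rewrite -mulr_suml -mulr_suml.
  by rewrite sum_sample_weight mul1r.
apply: le_trans decouple _.
rewrite -(@mean_cst R {ffun 'I_k -> bool} (\sum_q _)) ?card_signs_gt0//.
apply: le_trans (mean_le swapped) _; rewrite meanZ ler_pM2l//.
rewrite mean_sum; apply: le_trans (_ : \sum_J sample_weight J * B <= _); last first.
  by rewrite -mulr_suml sum_sample_weight mul1r.
apply: ler_sum => J _; rewrite meanZ.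
by apply: ler_wpM2l; [exact: sample_weight_ge0 | exact: uB].
Qed.

End Symmetrization.
End Sampling.

Section HellyDuality.
Context (R : realType) (X : normedModType R).

(** Draw indices independently with probabilities [lam i] proportional to
    [|f i|], and let [z J] be a common point in the unit ball of the sets drawn.
    The point [c i] is the average of the [z J] over the draws equal to [i],
    which is in [C i] by convexity.  With [u i] the normalized functionals, the
    mean of the sum over [j] of [u (J j) (z J)] is, up to the factor [k] and
    the normalization, the sum of the [f i (c i)]; on the other hand it is at
    least minus the mean norm of the sum of the [u (J j)]. *)
Lemma sampled_points (I : finType) (C : I -> set X) (k : nat) (B : R)
    (f : I -> dual X) : (0 < k)%N -> 0 <= B ->
  (forall u : 'I_k -> dual X, (forall j, `|u j| <= 1) ->
    mean (fun e : {ffun 'I_k -> bool} => `|\sum_j (-1) ^+ e j *: u j|) <= B) ->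
  (forall i x y a, C i x -> C i y -> 0 <= a <= 1 -> C i (a *: x + (1 - a) *: y)) ->
  (forall J : 'I_k -> I, exists2 z, `|z| <= 1 & forall j, C (J j) z) ->
  \sum_i f i = 0 -> \sum_i `|f i| <= 1 ->
  exists2 c : I -> X, forall i, C i (c i) & - (2 * B / k%:R) <= \sum_i f i (c i).
Proof.
move=> k0 B0 typeB Cconv Cint f0 f1.
have kR : 0 < k%:R :> R by rewrite ltr0n.
have /boolp.choice[p pC] : forall i, exists z, C i z.
  by move=> i; have [z _ zC] := Cint (fun=> i); exists z; exact: (zC (Ordinal k0)).
set L := \sum_i `|f i| in f1.
have L0 : 0 <= L by apply: sumr_ge0 => i _; exact: normr_ge0.
have [Lz|Lz] := eqVneq L 0.
  exists p => //; rewrite big1 => [|i _].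
    by rewrite oppr_le0 divr_ge0// ?mulr_ge0// ltW.
  move/eqP: Lz; rewrite psumr_eq0// => /allP/(_ i (mem_index_enum _))/=.
  by rewrite normr_eq0 => /eqP ->.
have Lp : 0 < L by rewrite lt_neqAle eq_sym Lz.
pose lam i := `|f i| / L.
pose u i := `|f i|^-1 *: f i.
have lam0 i : 0 <= lam i by rewrite divr_ge0.
have lam1 : \sum_i lam i = 1 by rewrite -mulr_suml divff.
have lamu i : lam i *: u i = L^-1 *: f i.
  rewrite scalerA; have [->|fi0] := eqVneq (f i) 0; first by rewrite !scaler0.
  by congr (_ *: _); rewrite /lam; field; rewrite ?Lz ?normr_eq0 ?fi0.
have u1 i : `|u i| <= 1.
  rewrite normrZ normfV normr_id; have [->|fi0] := eqVneq `|f i| 0.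
    by rewrite mulr0.
  by rewrite mulVf.
have u_mean0 : \sum_i lam i *: u i = 0.
  by rewrite (eq_bigr _ (fun i _ => lamu i)) -scaler_sumr f0 scaler0.
have sym := symmetrization lam0 lam1 u_mean0 (fun J => typeB _ (fun j => u1 (J j))).
have /boolp.choice[z zP] : forall J : {ffun 'I_k -> I}, exists z, `|z| <= 1 /\ forall j, C (J j) z.
  by move=> J; have [z z1 zC] := Cint J; exists z.
pose w (q : 'I_k * {ffun 'I_k -> I}) := sample_weight lam q.2.
have /boolp.choice[c cP] : forall i, exists c, C i c /\
    \sum_(q : 'I_k * {ffun 'I_k -> I} | q.2 q.1 == i) w q *: z q.2 = (k%:R * lam i) *: c.
  move=> i; have [|q qi|c Cc cE] := @convex_sum R X (C i) (p i) _
      (index_enum _) (fun q : 'I_k * {ffun 'I_k -> I} => q.2 q.1 == i)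
      w (fun q => z q.2) (Cconv i) (pC i).
  - by move=> q _; exact: sample_weight_ge0.
  - by have [_ /(_ q.1)] := zP q.2; rewrite (eqP qi).
  exists c; split=> //; rewrite cE; congr (_ *: _).
  rewrite -(pair_big_dep predT (fun j (J : {ffun 'I_k -> I}) => J j == i)
    (fun j J => sample_weight lam J))/=.
  rewrite (eq_bigr (fun=> lam i)) => [|j _]; last exact: sample_weight_marginal.
  by rewrite sumr_const card_ord mulr_natl.
exists c => [i|]; first by have [] := cP i.
have key : k%:R * (L^-1 * \sum_i f i (c i)) =
    \sum_J sample_weight lam J * (\sum_j u (J j)) (z J).
  rewrite !mulr_sumr.
  transitivity (\sum_i \sum_(q : 'I_k * {ffun 'I_k -> I} | q.2 q.1 == i)
      w q * u (q.2 q.1) (z q.2)).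
    apply: eq_bigr => i _; have [_ cE] := cP i.
    transitivity (u i ((k%:R * lam i) *: c i)).
      rewrite dualZ -mulrA; congr (_ * _).
      have -> : lam i * u i (c i) = (lam i *: u i : dual X) (c i) by [].
      by rewrite lamu.
    rewrite -cE dual_sum_arg; apply: eq_bigr => q /eqP ->//.
  transitivity (\sum_(q : 'I_k * {ffun 'I_k -> I}) w q * u (q.2 q.1) (z q.2)).
    exact/esym/(partition_big (fun q : 'I_k * {ffun 'I_k -> I} => q.2 q.1) predT).
  rewrite -(pair_big predT predT (fun j J => sample_weight lam J * u (J j) (z J)))/=.
  rewrite exchange_big; apply: eq_bigr => J _; rewrite -mulr_sumr; congr (_ * _).
  by elim/big_rec2 : _ => // j a g _ ->.
have low : - (2 * B) <= k%:R * (L^-1 * \sum_i f i (c i)).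
  rewrite key lerNl -sumrN; apply: le_trans sym; apply: ler_sum => J _.
  rewrite -mulrN ler_wpM2l ?sample_weight_ge0//.
  have [z1 _] := zP J; apply: le_trans (ler_norm _) _; rewrite normrN.
  by apply: le_trans (dual_bound _ _) _; rewrite ler_piMr.
set s := \sum_i f i (c i) in low *.
have {}low : - (2 * B / k%:R) * L <= s.
  rewrite -mulNr -ler_pdivlMr// mulrC -ler_pdivlMl ?invr_gt0// invrK.
  by rewrite [s / L]mulrC.
apply: le_trans low.
by rewrite mulNr lerN2 ler_piMr// divr_ge0 ?mulr_ge0// ltW.
Qed.

End HellyDuality.

(** * The Helly approximation property from type of the dual *)

Section Separation.
Context (R : realType) (X : normedModType R).

Definition max_norm (I : finType) (z : {ffun I -> X}) : R :=
  \big[Num.max/0]_i `|z i|.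

Lemma max_norm_le (I : finType) (z : {ffun I -> X}) (a : R) : 0 <= a ->
  (forall i, `|z i| <= a) -> max_norm z <= a.
Proof. by move=> a0 za; apply: bigmax_le. Qed.

Lemma le_max_norm (I : finType) (z : {ffun I -> X}) i : `|z i| <= max_norm z.
Proof. exact: le_bigmax. Qed.

Lemma max_norm_ge0 (I : finType) (z : {ffun I -> X}) : 0 <= max_norm z.
Proof. exact: bigmax_ge_id. Qed.

Lemma sublinear_max_norm (I : finType) : sublinear (@max_norm I).
Proof.
apply: sublinear_of_le.
- move=> x y; apply: max_norm_le; first by rewrite addr_ge0// max_norm_ge0.
  by move=> i; rewrite ffunE (le_trans (ler_normD _ _))// lerD// le_max_norm.
- apply/eqP; rewrite eq_le max_norm_ge0 andbT; apply: max_norm_le => // i.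
  by rewrite ffunE normr0.
- move=> a x a0; apply: max_norm_le; first by rewrite mulr_ge0 ?max_norm_ge0// ltW.
  by move=> i; rewrite ffunE normrZ gtr0_norm// ler_pM2l// le_max_norm.
Qed.

(** In the product of copies of [X] with the maximum norm, the vectors of
    coordinates [x - c i] form a convex set at distance at least [r] from 0.
    The coordinates [f i] of a separating functional have sum zero because [x]
    is unrestricted, and their norms add up to at most 1 because the norm dual
    to the maximum is the sum. *)
Lemma separating_functionals (I : finType) (C : I -> set X) (r : R) :
  (forall i, C i !=set0) ->
  (forall i x y a, C i x -> C i y -> 0 <= a <= 1 -> C i (a *: x + (1 - a) *: y)) ->
  (forall x (c : I -> X), (forall i, C i (c i)) -> exists i, r <= `|x - c i|) ->
  exists f : I -> dual X, [/\ \sum_i f i = 0, \sum_i `|f i| <= 1 &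
    forall c : I -> X, (forall i, C i (c i)) -> \sum_i f i (c i) <= - r].
Proof.
move=> C0 Cconv far.
pose D : set {ffun I -> X} := [set d | exists x (c : I -> X),
  (forall i, C i (c i)) /\ d = [ffun i => x - c i]].
have [d e a||Phi Phile PhiD] := @convex_separation R _ _ D r (@sublinear_max_norm I).
- move=> [x [c [cC ->]]] [y [b [bC ->]]] a01.
  exists (a *: x + (1 - a) *: y), (fun i => a *: c i + (1 - a) *: b i).
  split=> [i|]; first exact: Cconv.
  by apply/ffunP => i; rewrite !ffunE !scalerBr opprD addrACA.
- move=> _ [x [c [cC ->]]]; have [i ri] := far x c cC.
  by apply: le_trans ri _; have := le_max_norm [ffun i => x - c i] i; rewrite ffunE.
pose single i (x : X) : {ffun I -> X} := [ffun j => if j == i then x else 0].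
have single_lin i : linear (single i).
  move=> a x y; apply/ffunP => j; rewrite !ffunE; case: ifP => // _.
  by rewrite scaler0 addr0.
have /boolp.choice[f fE] : forall i, exists f : dual X, f =1 (fun x => Phi (single i x)).
  move=> i.
  have gl : linear ((fun x => Phi (single i x)) : X -> R^o).
    by move=> a x y; rewrite single_lin linearP.
  pose g : {linear X -> R^o} := HB.pack ((fun x => Phi (single i x)) : X -> R^o)
    (GRing.isLinear.Build _ _ _ _ _ gl).
  have [|f _ fg] := @dual_of_linear _ _ g 1 ler01; last by exists f.
  move=> x; rewrite mul1r; apply: le_trans (Phile _) _; apply: max_norm_le => // j.
  by rewrite ffunE; case: ifP; rewrite ?normr0.
have PhiE z : Phi z = \sum_i f i (z i).
  under eq_bigr do rewrite fE.
  rewrite -linear_sum; congr (Phi _); apply/ffunP => j.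
  rewrite sum_ffunE (bigD1 j)//= ffunE eqxx big1 ?addr0// => i ij.
  by rewrite ffunE eq_sym (negbTE ij).
have PhiDE x (c : I -> X) : (forall i, C i (c i)) ->
    r <= \sum_i f i x - \sum_i f i (c i).
  move=> cC; have : D [ffun i => x - c i] by exists x, c.
  move=> /PhiD; rewrite PhiE -sumrB; congr (_ <= _).
  by apply: eq_bigr => i _; rewrite ffunE dualB.
have /boolp.choice[p pC] : forall i, exists z, C i z by [].
have f0 x : \sum_i f i x = 0.
  apply/eqP/negPn/negP => g0; set g := \sum_i f i x in g0.
  (* A multiple of [x] at which the inequality would read [rho <= rho - 1]. *)
  pose rho := r + \sum_i f i (p i).
  have := PhiDE (((rho - 1) / g) *: x) p pC.
  rewrite (eq_bigr (fun i => (rho - 1) / g * f i x)) => [|i _]; last exact: dualZ.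
  by rewrite -mulr_sumr -/g divfK// /rho; lra.
exists f; split.
- apply/val_inj/funext => x /=; rewrite -[RHS](f0 x).
  have -> : dual_val (\sum_i f i) x = (\sum_i f i : dual X) x by [].
  by elim/big_rec2 : _ => // i a g _ <-.
- rewrite leNgt; apply/negP => L1; set L := \sum_i `|f i| in L1.
  pose delta := (L - 1) / (#|I|%:R + 1).
  have n0 : 0 <= #|I|%:R :> R by [].
  have delta0 : 0 < delta by rewrite divr_gt0; lra.
  have /boolp.choice[x xP] : forall i, exists x, `|x| <= 1 /\ `|f i| - delta < f i x.
    move=> i; have [|x x1 fx] := @dual_norm_approx _ _ (f i) (`|f i| - delta).
      by lra.
    by exists x.
  have : \sum_i f i (x i) <= 1.
    rewrite (_ : \sum_i f i (x i) = Phi [ffun i => x i]).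
      apply: le_trans (Phile _) _; apply: max_norm_le => // i.
      by rewrite ffunE; have [] := xP i.
    by rewrite PhiE; apply: eq_bigr => i _; rewrite ffunE.
  have : L - #|I|%:R * delta <= \sum_i f i (x i).
    rewrite /L mulr_natl -sumr_const -sumrB; apply: ler_sum => i _.
    by have [_ /ltW] := xP i.
  have : (#|I|%:R + 1) * delta = L - 1 by rewrite /delta mulrC divfK// gt_eqF//; lra.
  by lra.
- by move=> c cC; have := PhiDE 0 c cC; rewrite f0; lra.
Qed.

Lemma family_type_sequence : ~ almost_isometric_l1n X ->
  exists K h : R, [/\ 0 <= K, h < 1 & forall (k : nat) (u : 'I_k -> X),
    (forall j, `|u j| <= 1) ->
    mean (fun e : {ffun 'I_k -> bool} => `|\sum_j (-1) ^+ e j *: u j|) <=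
    K * k%:R `^ h].
Proof.
move=> /l2_type_of_not_l1n[K [h [K0 /andP[h0 h1] hK]]].
exists (Num.sqrt K), h; split=> //.
move=> k u u1; set F := fun e : {ffun _ -> _} => _.
rewrite -(@ler_pXn2r _ 2)// ?nnegrE; last 2 first.
- by apply: mean_ge0 => e; exact: normr_ge0.
- by rewrite mulr_ge0 ?sqrtr_ge0 ?powR_ge0.
apply: le_trans (sqr_mean_le _ (card_signs_gt0 _)) _.
apply: le_trans (hK _ u) _; rewrite exprMn sqr_sqrtr// ler_wpM2l//.
rewrite lerXn2r ?nnegrE ?powR_ge0//; apply: (ge0_ler_powR (ltW h0)); rewrite ?nnegrE//.
  by apply: sumr_ge0 => j _; exact: powR_ge0.
rewrite -[k in leRHS]card_ord -sumr_const; apply: ler_sum => j _.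
have -> : 1 = 1 `^ h^-1 :> R by rewrite powR1.
have hV : 0 <= h^-1 by rewrite invr_ge0 ltW.
by apply: (ge0_ler_powR hV); rewrite ?nnegrE ?u1.
Qed.

Lemma cvg_powR_neg (C d : R) : 0 < d -> (fun k : nat => C / k%:R `^ d) @ \oo --> (0 : R).
Proof.
move=> d0; apply/cvgrPdist_lt => eps eps0.
pose a := ((`|C| + 1) / eps) `^ d^-1.
near=> k; rewrite sub0r normrN normrM normfV.
have ak : a < k%:R by near: k; exact: nbhs_infty_gtr.
have c0 : 0 < (`|C| + 1) / eps by rewrite divr_gt0// ltr_wpDl.
have k0 : 0 < k%:R :> R by apply: le_lt_trans ak; exact: powR_ge0.
have : (`|C| + 1) / eps < k%:R `^ d.
  have -> : (`|C| + 1) / eps = a `^ d by rewrite -powRrM mulVf ?gt_eqF// powRr1// ltW.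
  by apply: (gt0_ltr_powR d0); rewrite ?nnegrE ?powR_ge0// ltW.
rewrite ltr_pdivrMr// => h.
rewrite (ger0_norm (powR_ge0 _ _)) ltr_pdivrMr ?powR_gt0//; lra.
Unshelve. all: by end_near. Qed.

End Separation.

Section HellyFromDual.
Context (R : realType) (X : normedModType R).

(** The sampled points satisfy the lower bound [- 2 * K / k ^ (1 - h)], which
    contradicts the upper bound [- r] of the separating functionals for any
    larger [r]; the summand 1 in the numerator makes [r] larger. *)
Lemma Helly_of_not_l1n_dual :
  ~ almost_isometric_l1n (dual X) -> Helly_approximation_property X.
Proof.
move=> /family_type_sequence[K [h [K0 h1 typeK]]].
have d0 : 0 < 1 - h by lra.
exists (fun k => (2 * K + 1) / k%:R `^ (1 - h)); last exact: cvg_powR_neg.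
move=> k k0 F finF Fconv Fint.
have kR : 0 < k%:R :> R by rewrite ltr0n.
set r := (2 * K + 1) / _.
have [s Fs] := (finite_seqP F).1 finF.
have FsP (i : 'I_(size s)) : F (nth set0 s i) by rewrite Fs /=; exact: mem_nth.
pose C (i : 'I_(size s)) := nth set0 s i.
have Cconv i x y a : C i x -> C i y -> 0 <= a <= 1 -> C i (a *: x + (1 - a) *: y).
  by move: x y a; apply/convex_setE; exact: Fconv (FsP i).
have Cint (J : 'I_k -> 'I_(size s)) : exists2 z, `|z| <= 1 & forall j, C (J j) z.
  have [z [z1 zC]] := Fint (C \o J) (fun j => FsP (J j)).
  by exists z => // j; exact: (zC j I).
have C0 i : C i !=set0.
  by have [z _ zC] := Cint (fun=> i); exists z; exact: (zC (Ordinal k0)).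
apply: contrapT => nocommon.
have [x c cC|f [f0 f1 fr]] := @separating_functionals _ _ _ C r C0 Cconv.
  apply: contrapT => near; apply: nocommon; exists x => A.
  rewrite Fs /= => As; pose i := Ordinal (etrans (index_mem A s) As).
  have iA : C i = A by rewrite /C /= nth_index.
  have ri : `|x - c i| < r.
    by rewrite ltNge; apply/negP => ri; apply: near; exists i.
  rewrite /neighborhood /=; apply: (@le_trans _ _ (`|x - c i|)%:E); last first.
    by rewrite lee_fin ltW.
  by apply: ereal_inf_lbound; exists (c i) => //; rewrite -iA.
have B0 : 0 <= K * k%:R `^ h by rewrite mulr_ge0 ?powR_ge0.
have [c cC low] := sampled_points k0 B0 (typeK k) Cconv Cint f0 f1.
have := le_trans low (fr c cC); rewrite lerN2 leNgt => /negP; apply.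
have kE : k%:R = k%:R `^ (1 - h) * k%:R `^ h :> R.
  by rewrite -powRD ?subrK ?powRr1 ?(gt_eqF kR) ?implybT// ltW.
have kh : 0 < k%:R `^ (1 - h) :> R by exact: powR_gt0.
have kh' : 0 < k%:R `^ h :> R by exact: powR_gt0.
have -> : 2 * (K * k%:R `^ h) / k%:R = 2 * K / k%:R `^ (1 - h).
  by rewrite {2}kE; field; rewrite !gt_eqF.
by rewrite /r ltr_pM2r ?invr_gt0// ltrDl.
Qed.

End HellyFromDual.

Theorem theorem1p3 (R : realType) (X : completeNormedModType R) :
  (Helly_approximation_property X <-> nontrivial_type (dual X)) /\
  (nontrivial_type (dual X) <-> nontrivial_type X).
Proof.
split; rewrite nontrivial_typeP.
  split; [exact: not_l1n_dual_of_Helly | exact: Helly_of_not_l1n_dual].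
by rewrite nontrivial_typeP l1n_dualP.
Qed.
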